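(* Let $n\in\mathbb{N}$, let $T\in M(n;\mathbb{C})$ with $\mathrm{Im}\,T$ positive definite and $\det T\neq 0$, and let $\tau\in M(n;\mathbb{R})$ be an alternating matrix. Let $X^n=\mathbb{C}^n/(\mathbb{Z}^n\oplus T\mathbb{Z}^n)$ and let $X^n_{\mathcal{G}_\tau^\nabla}$ be its deformation by the flat gerbe $\mathcal{G}_\tau^\nabla$. Then the twisted holomorphic line bundles with twisted integrable connections $E^{\nabla}_{(s,a,q)}(\tau)$ on $X^n_{\mathcal{G}_\tau^\nabla}$, together with the graded morphism spaces, the linear maps $d_{12}^r$ and the compositions $m$ defined in the context, form a dg-category $DG_{X^n_{\mathcal{G}_\tau^\nabla}}$.
   Context: Notation. $M(n;R)$ is the set of $n\times n$ matrices over $R$; $A^t$ is the transpose; $\mathbf{i}=\sqrt{-1}$; $e_j$ is the $j$-th standard basis vector. $T$ is not assumed symmetric. Alternating means $\tau^t=-\tau$. For vectors of 1-forms $dx=(dx_1,\dots,dx_n)^t$ etc., $dx^t A\,dy:=\sum_{i,j}A_{ij}\,dx_i\wedge dy_j$ and $dx^tA\,dx:=\sum_{i,j}A_{ij}\,dx_i\wedge dx_j$. Torus and covering. $X^n=\mathbb{C}^n/(\mathbb{Z}^n\oplus T\mathbb{Z}^n)$ has complex coordinates $z=x+Ty$, $x,y\in\mathbb{R}^n$, with $x_i\sim x_i+1$, $y_i\sim y_i+1$. Fix a small $\epsilon>0$. For $l=(l_1,\dots,l_n)$, $m=(m_1,\dots,m_n)$ with $l_j,m_k\in\{1,2,3\}$,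 let $O^l_m\subset X^n$ be the open set $\frac{l_j-1}{3}-\epsilon<x_j<\frac{l_j}{3}+\epsilon$, $\frac{m_k-1}{3}-\epsilon<y_k<\frac{m_k}{3}+\epsilon$ ($j,k=1,\dots,n$), with these $(x,y)$ as local coordinates. Let $I$ be the set of all $(l;m)$. Flat gerbe. $\mathcal{G}_\tau^\nabla$ is the trivial gerbe on $X^n$ (for the covering $\{O_m^l\}$, trivial line bundles on double overlaps, sections $1$ on triple overlaps) with the following 0-connection and 1-connection. On an overlap where the $x$-coordinate $x'$ of $O^{l'}_{m'}$ and the $x$-coordinate $x$ of $O^l_m$ are related by $x'=x+v$, $v\in\mathbb{Z}^n$, the 0-connection is $d-\mathbf{i}\,\pi v^t\tau\,dx$ for the ordered pair $((l;m),(l';m'))$ (in particular $d-\pi\mathbf{i}\,\tau_j^tdx$, $\tau_j=(\tau_{j1},\dots,\tau_{jn})^t$, when $v=e_j$, and $d$ when $v=0$). The 1-connection is the global 2-form $-\pi\mathbf{i}\,dx^t\tau\,dx$. $X^n_{\mathcal{G}_\tau^\nabla}$ denotes $X^n$ equipped with this flat gerbe (equivalently, with the B-field transform by $\pi\,dx^t\tau\,dx$ of its generalized complex structure); its underlying manifold and the type decomposition of differential forms are those of the complex torus $X^n$. The bundles. Let $a=(a_1,\dots,a_n)\in M(n;\mathbb{Z})$ with columns $a_j\in\mathbb{Z}^n$, let $q\in\mathbb{R}^n$, and let $s=(s^1,\dots,s^n)^t$ be a smooth function of $x$ with $s(x+e_j)=s(x)+a_j$ for $j=1,\dots,n$. The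 line bundle $E^\tau_{(s,a,q)}$ is the smooth complex line bundle on $X^n$ (viewed as an $id$-twisted line bundle, i.e. with transition functions satisfying the ordinary cocycle condition) whose local sections satisfy $\psi(x+e_j,y)=\exp(2\pi\mathbf{i}\,a_j^ty)\,\psi(x,y)$ and $\psi(x,y+e_k)=\psi(x,y)$; i.e. on the overlaps across $x_j=0\sim 1$ one has $\psi^{(l_j=3)}=\exp(2\pi\mathbf{i}a_j^ty)\,\psi^{(l_j=1)}$. The twisted connection on it is given on each $O_m^l$ by $$\nabla^\tau_{(s,a,q)}=d+\omega^\tau_{(s,a,q)},\qquad \omega^\tau_{(s,a,q)}=-2\pi\mathbf{i}\,\bigl(s(x)^t+q^tT\bigr)dy-\pi\mathbf{i}\,x^t\tau\,dx .$$ (Twisted connection means: if $\varphi_{\alpha\beta}$ are the transition functions and $d+\omega_{\alpha\beta}$ is the 0-connection of the gerbe, then $\nabla_\beta-\varphi_{\alpha\beta}^{-1}\nabla_\alpha\varphi_{\alpha\beta}=\omega_{\alpha\beta}$ on overlaps.) Its ''local'' curvature form is $\tilde\Omega^\tau_{(s,a,q)}:=d\omega^\tau_{(s,a,q)}$, and its curvature form is $\Omega^\tau_{(s,a,q)}:=\tilde\Omega^\tau_{(s,a,q)}-(-\pi\mathbf{i}\,dx^t\tau\,dx)$, a global 2-form. The twisted connection is called a twisted integrable connection if the $(0,2)$-part of $\Omega^\tau_{(s,a,q)}$ vanishes. Write $E^\nabla_{(s,a,q)}(\tau):=(E^\tau_{(s,a,q)},\nabla^\tau_{(s,a,q)})$.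 The data of $DG_{X^n_{\mathcal{G}_\tau^\nabla}}$. Objects: the $E^\nabla_{(s,a,q)}(\tau)$ for which $\nabla^\tau_{(s,a,q)}$ is a twisted integrable connection. Write $E_i=E^\nabla_{(s^i,a^i,q^i)}(\tau)$ ($i=1,2,3$). Morphisms: $\mathrm{Hom}(E_1,E_2)=\bigoplus_{r\ge 0}\mathrm{Hom}^r(E_1,E_2)$, $\mathrm{Hom}^r(E_1,E_2)=\Gamma(E_1,E_2)\otimes_{C^\infty(X^n)}\Omega^{(0,r)}(X^n)$, where $\Gamma(E_1,E_2)$ is the space of smooth bundle homomorphisms (families compatible with the transition functions) and $\Omega^{(0,r)}$ is the space of smooth $(0,r)$-forms; $r$ is the degree. An element of $\mathrm{Hom}^r(E_1,E_2)$ is written as a family $\{\phi^{12}_{(l;m)}\}_{(l;m)\in I}$ of local $(0,r)$-forms on the $O_m^l$. Differential: $d_{12}^r:\mathrm{Hom}^r(E_1,E_2)\to\mathrm{Hom}^{r+1}(E_1,E_2)$, $$d_{12}^r(\{\phi^{12}_{(l;m)}\})=\Bigl\{(\nabla^\tau_{(s^2,a^2,q^2)})^{(0,1)}\phi^{12}_{(l;m)}-(-1)^r\phi^{12}_{(l;m)}(\nabla^\tau_{(s^1,a^1,q^1)})^{(0,1)}\Bigr\},$$ i.e. locally $\bar\partial\phi+(\omega^\tau_{(s^2,a^2,q^2)})^{(0,1)}\wedge\phi-(-1)^r\phi\wedge(\omega^\tau_{(s^1,a^1,q^1)})^{(0,1)}$. Composition: $m:\mathrm{Hom}^{r_2}(E_2,E_3)\otimes\mathrm{Hom}^{r_1}(E_1,E_2)\to\mathrm{Hom}^{r_1+r_2}(E_1,E_3)$,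 $m(\{\phi^{23}_{(l;m)}\},\{\phi^{12}_{(l;m)}\})=\{\phi^{23}_{(l;m)}\wedge\phi^{12}_{(l;m)}\}$. The Leibniz rule convention is $d\,m(\phi^{23},\phi^{12})=m(d\phi^{23},\phi^{12})+(-1)^{r_2}m(\phi^{23},d\phi^{12})$. *)

(* Defs.v *)
From HB Require Import structures.
From mathcomp Require Import all_boot all_order all_algebra.
From mathcomp Require Import complex ring.
From mathcomp Require Import all_classical all_reals all_analysis.
Import Order.TTheory GRing.Theory Num.Theory numFieldNormedType.Exports.

Set Implicit Arguments.
Unset Strict Implicit.
Unset Printing Implicit Defensive.

Local Open Scope classical_set_scope.
Local Open Scope ring_scope.
Local Open Scope complex_scope.

(* A dg-category over K whose graded hom-spaces are given as subspaces
   hom X Y r of an ambient K-module V X Y, on which the differential and the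
   composition are defined; cohomological grading by r >= 0. *)
Record is_dg_category (K : pzRingType) (Obj : Type)
    (V : Obj -> Obj -> lmodType K)
    (hom : forall X Y : Obj, nat -> set (V X Y))
    (d : forall X Y : Obj, nat -> V X Y -> V X Y)
    (m : forall X Y Z : Obj, V Y Z -> V X Y -> V X Z) : Prop := IsDgCategory {
  dg_hom0 : forall X Y r, hom X Y r 0;
  dg_homP : forall X Y r (c : K) u v,
    hom X Y r u -> hom X Y r v -> hom X Y r (c *: u + v);
  dg_diff_hom : forall X Y r u, hom X Y r u -> hom X Y r.+1 (d X Y r u);
  dg_diff_linear : forall X Y r (c : K) u v, hom X Y r u -> hom X Y r v ->
    d X Y r (c *: u + v) = c *: d X Y r u + d X Y r v;
  dg_diff_diff : forall X Y r u, hom X Y r u -> d X Y r.+1 (d X Y r u) = 0;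
  dg_comp_hom : forall X Y Z r2 r1 u v, hom Y Z r2 u -> hom X Y r1 v ->
    hom X Z (r1 + r2)%N (m X Y Z u v);
  dg_comp_linearl : forall X Y Z r2 r1 (c : K) u u' v,
    hom Y Z r2 u -> hom Y Z r2 u' -> hom X Y r1 v ->
    m X Y Z (c *: u + u') v = c *: m X Y Z u v + m X Y Z u' v;
  dg_comp_linearr : forall X Y Z r2 r1 (c : K) u v v',
    hom Y Z r2 u -> hom X Y r1 v -> hom X Y r1 v' ->
    m X Y Z u (c *: v + v') = c *: m X Y Z u v + m X Y Z u v';
  dg_leibniz : forall X Y Z r2 r1 u v, hom Y Z r2 u -> hom X Y r1 v ->
    d X Z (r1 + r2)%N (m X Y Z u v)
    = m X Y Z (d Y Z r2 u) v + (-1) ^+ r2 *: m X Y Z u (d X Y r1 v);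
  dg_compA : forall W X Y Z r3 r2 r1 u v w,
    hom Y Z r3 u -> hom X Y r2 v -> hom W X r1 w ->
    m W Y Z u (m W X Y v w) = m W X Z (m X Y Z u v) w;
  dg_unit : forall X, exists2 e, hom X X 0%N e /\ d X X 0%N e = 0 &
    (forall Y r u, hom X Y r u -> m X X Y u e = u) /\
    (forall Y r u, hom Y X r u -> m Y X X e u = u)
}.

Definition posdef (R : numDomainType) n (A : 'M[R]_n) : Prop :=
  forall v : 'cV[R]_n, v != 0 -> 0 < (v^T *m A *m v) 0 0.

Section Smooth.
Variables (R : realType) (m : nat).
Implicit Types (U : set 'cV[R]_m) (v : 'cV[R]_m).

(* For U open: U-continuity of f and of all its iterated partial derivatives;
   'D_v f is a total function, but on U it only depends on f restricted to U. *)
Fixpoint Ck k U (f : 'cV[R]_m -> R) : Prop :=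
  if k is k'.+1 then
    forall i : 'I_m, (forall p, U p -> derivable f p (delta_mx i 0)) /\
      Ck k' U (fun p => 'D_(delta_mx i 0) f p)
  else forall p, U p -> {for p, continuous f}.

Definition smooth U (f : 'cV[R]_m -> R) : Prop := forall k, Ck k U f.

Definition Csmooth U (f : 'cV[R]_m -> R[i]) : Prop :=
  smooth U (fun p => complex.Re (f p)) /\ smooth U (fun p => complex.Im (f p)).

Definition Cderive v (f : 'cV[R]_m -> R[i]) (p : 'cV[R]_m) : R[i] :=
  'D_v (fun p' => complex.Re (f p')) p +i* 'D_v (fun p' => complex.Im (f p')) p.

End Smooth.

(* The exterior algebra of a free module with basis e_0, ..., e_(k-1): the
   coordinate at A = {i_1 < ... < i_r} is that of e_(i_1) /\ ... /\ e_(i_r). *)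
Section Exterior.
Variables (K : comNzRingType) (k : nat).

Definition ext := {ffun {set 'I_k} -> K^o}.
HB.instance Definition _ := GRing.Lmodule.on ext.

Definition blade (A : {set 'I_k}) : ext := [ffun B => (B == A)%:R].

Definition inversions (A B : {set 'I_k}) : nat :=
  #|[set ij : 'I_k * 'I_k | [&& ij.1 \in A, ij.2 \in B & (ij.2 < ij.1)%N]]%SET|.

Definition wedge (u v : ext) : ext :=
  [ffun C : {set 'I_k} => \sum_(A : {set 'I_k} | A \subset C)
     (-1) ^+ inversions A (C :\: A) * (u A : K) * (v (C :\: A) : K)].

End Exterior.

Section Torus.
Variables (R : realType) (n : nat).

Local Notation C := R[i].
Local Notation toC := (map_mx (real_complex R)).
Local Notation toR := (map_mx (intr : int -> R)).

(* The point with real coordinates (x, y) is col_mx x y. *)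
Definition pt := 'cV[R]_(n + n).
Definition xcoord (p : pt) : 'cV[R]_n := usubmx p.
Definition ycoord (p : pt) : 'cV[R]_n := dsubmx p.

(* O_(l;m), with l_j and m_k numbered from 0. *)
Definition chart := ({ffun 'I_n -> 'I_3} * {ffun 'I_n -> 'I_3})%type.

Definition open_arc (eps : R) (l : 'I_3) : set R :=
  [set t | l%:R / 3%:R - eps < t < l.+1%:R / 3%:R + eps].

Definition box (eps : R) (c : chart) : set pt :=
  [set p | (forall j, open_arc eps (c.1 j) (xcoord p j 0)) /\
           (forall k, open_arc eps (c.2 k) (ycoord p k 0))].

Definition shift2 (v w : 'cV[int]_n) (p : pt) : pt :=
  p + col_mx (toR v) (toR w).

(* p and shift2 v w p are the coordinates, in b and c respectively, of the same
   point of the torus. *)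
Definition overlap eps (b c : chart) (v w : 'cV[int]_n) : set pt :=
  [set p | box eps b p /\ box eps c (shift2 v w p)].

Section Forms.
Variable T : 'M[C]_n.

(* Complex differential forms are written in the coframe
   (dz_1, ..., dz_n, dzbar_1, ..., dzbar_n), where z = x + T y: index lshift j
   stands for dz_j and rshift j for dzbar_j. *)
Definition covec := ext C (n + n).
HB.instance Definition _ := GRing.Lmodule.on covec.
Definition dform := pt -> covec.

Definition dz (j : 'I_n) : covec := blade C [set lshift n j]%SET.
Definition dzbar (j : 'I_n) : covec := blade C [set rshift n j]%SET.

(* The solution of dz = dx + T dy, dzbar = dx + Tbar dy; see dzE, dzbarE. *)
Definition dy (j : 'I_n) : covec :=
  \sum_k invmx (T - map_mx conjc T) j k *: (dz k - dzbar k).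
Definition dx (j : 'I_n) : covec := dz j - \sum_k T j k *: dy k.

Definition form1 (c : 'rV[C]_n) (eta : 'I_n -> covec) : covec :=
  \sum_j c 0 j *: eta j.
Definition form2 (A : 'M[C]_n) (eta theta : 'I_n -> covec) : covec :=
  \sum_i \sum_j A i j *: wedge (eta i) (theta j).

Definition scalar_form (f : pt -> C) : dform := fun p => f p *: blade C finset.set0.

Definition partial_form (i : 'I_(n + n)) (phi : dform) : dform :=
  fun p => [ffun A => Cderive (delta_mx i 0) (fun p' => phi p' A) p].

(* Exterior derivative; here lshift j and rshift j index the coordinates x_j
   and y_j. *)
Definition dext (phi : dform) : dform := fun p =>
  \sum_(j < n) (wedge (dx j) (partial_form (lshift n j) phi p) +
                wedge (dy j) (partial_form (rshift n j) phi p)).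

(* The component of type (a, b). *)
Definition type_part (a b : nat) (u : covec) : covec :=
  [ffun A : {set 'I_(n + n)} =>
    if (#|[set j | lshift n j \in A]%SET| == a) &&
       (#|[set j | rshift n j \in A]%SET| == b) then u A else 0].

Definition of_type a b (u : covec) : Prop := type_part a b u = u.

Definition dbar r (phi : dform) : dform := fun p => type_part 0 r.+1 (dext phi p).

Definition smooth_form (U : set pt) (phi : dform) : Prop :=
  forall A, Csmooth U (fun p => phi p A : C).

(* A connection on the trivial gerbe over the covering: conn0 b c v is the
   connection form of the 0-connection for the ordered pair (b, c), on the
   overlap x' = x + v. *)
Record gerbe := Gerbe {
  conn0 : chart -> chart -> 'cV[int]_n -> dform;
  conn1 : chart -> dform
}.

Definition flat_gerbe (tau : 'M[R]_n) : gerbe := {|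
  conn0 := fun _ _ v _ =>
    - ('i%C * pi%:C) *: form1 (toC ((toR v)^T *m tau)) dx;
  conn1 := fun _ _ => - (pi%:C * 'i%C) *: form2 (toC tau) dx dx
|}.

(* Transition functions psi_b = phi_bc psi_c, as a function of the shift
   x' = x + v, y' = y + w. *)
Definition transition := chart -> chart -> 'cV[int]_n -> 'cV[int]_n -> pt -> C.

(* The connections nabla_b = d + omega b, compared in the coordinates of b. *)
Definition twisted_connection (eps : R) (G : gerbe) (phi : transition)
    (omega : chart -> dform) : Prop :=
  forall b c v w p, overlap eps b c v w p ->
    omega c (shift2 v w p)
    - (omega b p +
       (phi b c v w p)^-1 *: dext (scalar_form (phi b c v w)) p)
    = conn0 G b c v p.

Definition curvature (G : gerbe) (omega : chart -> dform) : chart -> dform :=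
  fun b => dext (omega b) \- conn1 G b.

Definition twisted_integrable (eps : R) (G : gerbe) (phi : transition)
    (omega : chart -> dform) : Prop :=
  twisted_connection eps G phi omega /\
  forall b p, box eps b p -> type_part 0 2 (curvature G omega b p) = 0.

Record bundle_data := BundleData {
  s_fun : 'cV[R]_n -> 'cV[R]_n;
  a_mx : 'M[int]_n;
  q_vec : 'cV[R]_n;
  s_fun_smooth : forall i, smooth [set: 'cV[R]_n] (fun x => s_fun x i 0);
  s_fun_period : forall x j, s_fun (x + delta_mx j 0) = s_fun x + toR (col j a_mx)
}.

Definition cis (t : R) : C := cos t +i* sin t.

(* psi_c = exp(2 pi i (a v)^t y) psi_b where x' = x + v. *)
Definition trans (E : bundle_data) : transition := fun _ _ v _ p =>
  cis (- (2 * pi * ((toR (a_mx E *m v))^T *m ycoord p) 0 0)).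

Definition omega (tau : 'M[R]_n) (E : bundle_data) : chart -> dform :=
  fun _ p =>
  - (2 * pi%:C * 'i%C) *:
      form1 ((toC (s_fun E (xcoord p)))^T + (toC (q_vec E))^T *m T) dy
  - (pi%:C * 'i%C) *: form1 (toC ((xcoord p)^T *m tau)) dx.

(* Families of local forms. *)
Definition form_family := chart -> dform.
HB.instance Definition _ := GRing.Lmodule.on form_family.

Section DG.
Variables (tau : 'M[R]_n) (eps : R).

Record object := Object {
  obj_data :> bundle_data;
  obj_integrable : twisted_integrable eps (flat_gerbe tau) (trans obj_data)
        (omega tau obj_data)
}.

(* A local form on O_(l;m) is extended by 0, so that Leibniz equality is
   equality of families of local forms. *)
Definition hom_forms (E1 E2 : object) (r : nat) : set form_family :=
  [set phi | [/\ forall b p, ~ box eps b p -> phi b p = 0,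
      forall b, smooth_form (box eps b) (phi b),
      forall b p, box eps b p -> of_type 0 r (phi b p) &
      forall b c v w p, overlap eps b c v w p ->
        trans E2 b c v w p *: phi c (shift2 v w p)
        = trans E1 b c v w p *: phi b p]].

Definition hom_diff (E1 E2 : object) (r : nat) (phi : form_family) : form_family :=
  fun b => patch (fun=> 0) (box eps b) (fun p =>
    dbar r (phi b) p
    + wedge (type_part 0 1 (omega tau E2 b p)) (phi b p)
    - (-1) ^+ r *: wedge (phi b p) (type_part 0 1 (omega tau E1 b p))).

Definition hom_comp (E1 E2 E3 : object) (phi23 phi12 : form_family) : form_family :=
  fun b p => wedge (phi23 b p) (phi12 b p).

End DG.
End Forms.
End Torus.

Section WellDefined.
Variables (R : realType) (n : nat).
Local Notation C := R[i].
Local Notation toC := (map_mx (real_complex R)).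
Local Notation toR := (map_mx (intr : int -> R)).

Lemma Im_unitmx (T : 'M[C]_n) :
  posdef (map_mx (@complex.Im R) T) -> T - map_mx conjc T \in unitmx.
Proof.
set A := map_mx _ T => posA.
have Au : A \in unitmx.
  rewrite -unitmx_tr -row_free_unit -kermx_eq0.
  apply/eqP/row_matrixP => i; rewrite row0.
  apply/eqP/negPn/negP => v0.
  have /posA : (row i (kermx A^T))^T != 0.
    by apply: contra v0 => /eqP/(congr1 trmx); rewrite trmxK trmx0 => ->.
  have K0 : row i (kermx A^T) *m A^T = 0 by rewrite -row_mul mulmx_ker row0.
  have -> : (row i (kermx A^T))^T^T *m A *m (row i (kermx A^T))^T =
      row i (kermx A^T) *m (row i (kermx A^T) *m A^T)^T.
    by rewrite trmxK trmx_mul trmxK mulmxA.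
  rewrite K0 trmx0 mulmx0.
  by rewrite mxE ltxx.
have -> : T - map_mx conjc T = (2 * 'i%C) *: toC A.
  apply/matrixP => i j; rewrite !mxE subcJ; ring.
rewrite unitmxZ ?map_unitmx// unitfE mulf_neq0 ?pnatr_eq0//.
by rewrite eq_complex /= oner_eq0 andbF.
Qed.

Lemma dzE (T : 'M[C]_n) (j : 'I_n) :
  dx T j + \sum_k T j k *: dy T k = dz R j.
Proof. by rewrite /dx subrK. Qed.

Lemma dzbarE (T : 'M[C]_n) (j : 'I_n) : posdef (map_mx (@complex.Im R) T) ->
  dx T j + \sum_k conjc (T j k) *: dy T k = dzbar R j.
Proof.
move=> /Im_unitmx Tu; rewrite /dx.
rewrite -addrA [- _ + _]addrC -[X in _ + X]opprB -sumrB.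
have -> : \sum_k (T j k *: dy T k - conjc (T j k) *: dy T k) = dz R j - dzbar R j.
  pose N := T - map_mx conjc T.
  transitivity (\sum_k \sum_l (N j k * invmx N k l) *: (dz R l - dzbar R l)).
    apply: eq_bigr => k _; rewrite -scalerBl scaler_sumr.
    by apply: eq_bigr => l _; rewrite scalerA !mxE.
  rewrite exchange_big /= (bigD1 j)//= -[RHS]addr0; congr (_ + _).
    rewrite -scaler_suml; have := congr1 (fun M : 'M[C]_n => M j j) (mulmxV Tu).
    by rewrite !mxE eqxx => ->; rewrite scale1r.
  apply: big1 => l lj; rewrite -scaler_suml.
  have := congr1 (fun M : 'M[C]_n => M j l) (mulmxV Tu).
  by rewrite !mxE eq_sym (negPf lj) => ->; rewrite scale0r.
by rewrite opprB addrC subrK.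
Qed.

Lemma wedge_blade0 k (K : comNzRingType) (u : ext K k) (c : K) :
  wedge u (c *: blade K finset.set0) = c *: u.
Proof.
apply/ffunP => A; rewrite !ffunE (bigD1 A)//= big1 => [|B /andP[sBA nBA]].
  rewrite finset.setDv !ffunE eqxx addr0.
  suff -> : inversions A finset.set0 = 0%N.
    by rewrite expr0 mul1r [(c *: _ : K^o)]mulr1 mulrC.
  by apply: eq_card0 => ij; rewrite !inE !andbF.
rewrite !ffunE.
have /negPf -> : A :\: B != finset.set0.
  rewrite finset.setD_eq0; apply: contra nBA => sAB; rewrite finset.eqEsubset sBA sAB//.
by rewrite [(c *: _ : K^o)]mulr0 mulr0.
Qed.

Lemma partial_scalar (i : 'I_(n + n)) (f : pt R n -> C) p :
  partial_form i (scalar_form f) p =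
  Cderive (delta_mx i 0) f p *: blade C finset.set0.
Proof.
apply/ffunP => A; rewrite !ffunE /Cderive.
have E p' : (scalar_form f p' A : C) = f p' * (A == finset.set0)%:R by rewrite !ffunE.
under eq_fun do rewrite E; under [X in _ +i* 'D_ _ X _]eq_fun do rewrite E.
case: eqP => _.
  under eq_fun do rewrite mulr1; under [X in _ +i* 'D_ _ X _]eq_fun do rewrite mulr1.
  by rewrite [RHS]mulr1.
under eq_fun do rewrite mulr0; under [X in _ +i* 'D_ _ X _]eq_fun do rewrite mulr0.
by rewrite !derive_cst [RHS]mulr0.
Qed.

Lemma derive_line (f g : R -> R) (c : 'rV[R]_(n + n)) (p v : 'cV[R]_(n + n)) :
  (forall t : R, is_derive t 1 f (g t)) ->
  'D_v (fun p' => f ((c *m p') 0 0)) p = (c *m v) 0 0 * g ((c *m p) 0 0).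
Proof.
move=> fg.
have H : is_derive (0 : R) (1 : R) (fun t : R => f ((c *m p) 0 0 + t * (c *m v) 0 0))
   ((c *m v) 0 0 * g ((c *m p) 0 0)).
  have L : is_derive (0 : R) (1 : R) (fun t : R => (c *m p) 0 0 + t * (c *m v) 0 0) ((c *m v) 0 0).
    apply: is_derive_eq.
    rewrite add0r scaler0 add0r; by rewrite ?scale1r ?mul1r [X in X = _]mulr1.
  have F := fg ((c *m p) 0 0 + 0 * (c *m v) 0 0).
  have := @is_derive1_comp _ f (fun t : R => (c *m p) 0 0 + t * (c *m v) 0 0) _ _ _ F L.
  by rewrite mul0r addr0 mulrC.
rewrite -(@derive_val _ _ _ _ _ _ _ H) /derive.
apply: (congr1 (fun F : R -> R => lim (F @ 0^')%classic)); apply/funext => h /=.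
by rewrite /GRing.scale /= mulr1 addr0 mul0r addr0 mulmxDr -scalemxAr !mxE addrC.
Qed.

Lemma Cderive_cis (c : 'rV[R]_(n + n)) (v p : 'cV[R]_(n + n)) :
  Cderive v (fun p' => cis ((c *m p') 0 0)) p =
  'i%C * ((c *m v) 0 0)%:C * cis ((c *m p) 0 0).
Proof.
rewrite /Cderive /cis /=.
rewrite (@derive_line cos (fun t => - sin t)) (@derive_line sin cos).
apply/eqP; rewrite eq_complex /=; apply/andP; split; apply/eqP; ring.
Qed.

Lemma cis_neq0 (t : R) : cis t != 0.
Proof.
apply/negP => /eqP[c0 s0]; have := cos2Dsin2 t.
by rewrite c0 s0 expr0n /= addr0 => /eqP; rewrite eq_sym oner_eq0.
Qed.

Lemma cisD (t u : R) : cis (t + u) = cis t * cis u.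
Proof.
rewrite /cis cosD sinD; apply/eqP; rewrite eq_complex /=.
by apply/andP; split; apply/eqP; ring.
Qed.

Lemma cis_2piN (k : nat) : cis (2 * pi * k%:R : R) = 1.
Proof.
elim: k => [|k IH]; first by rewrite mulr0 /cis cos0 sin0.
rewrite -[k.+1]addn1 natrD mulrDr mulr1 cisD IH mul1r /cis.
by rewrite (mulrC 2) mulr_natr cos2pi sin2pi.
Qed.

Lemma cis_2piZ (k : int) : cis (2 * pi * k%:~R : R) = 1.
Proof.
case: k => k; first exact: cis_2piN.
rewrite NegzE; apply: (mulIf (cis_neq0 (2 * pi * k.+1%:R : R))).
rewrite -cisD -mulrDr mul1r cis_2piN.
by rewrite rmorphN /= addNr mulr0 /cis cos0 sin0.
Qed.

(* The ordinary cocycle condition. *)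
Lemma trans_cocycle (E : bundle_data R n) b c e v w v' w' p :
  trans E b c v w p * trans E c e v' w' (shift2 v w p) =
  trans E b e (v + v') (w + w') p.
Proof.
have ys : ycoord (shift2 v w p) = ycoord p + toR w.
  have H := col_mxKd (toR v) (toR w).
  by apply/matrixP => i k; rewrite -H !mxE.
have mapD (M N : 'cV[int]_n) : toR (M + N) = toR M + toR N :> 'cV[R]_n.
  by apply/matrixP => i k; rewrite !mxE rmorphD.
have intE : ((toR (a_mx E *m v'))^T *m toR w) 0 0
    = (((a_mx E *m v')^T *m w) 0 0)%:~R :> R.
  by rewrite !mxE rmorph_sum; apply: eq_bigr => i _; rewrite !mxE rmorphM.
rewrite /trans ys -cisD mulmxDr mulmxDr mapD (linearD trmx) mulmxDl.
rewrite ![(_ + _ : 'M[R]_1) 0 0]mxE intE -opprD -[RHS]mulr1.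
set k : int := ((a_mx E *m v')^T *m w) 0 0.
rewrite -[X in _ = _ * X](cis_2piZ (- k)) -cisD rmorphN; congr cis.
by rewrite !mulrDr; ring.
Qed.

Lemma s_fun_shift (E : bundle_data R n) x (v : 'cV[int]_n) :
  s_fun E (x + toR v) = s_fun E x + toR (a_mx E *m v).
Proof.
have E1 y j : s_fun E (y - delta_mx j 0) = s_fun E y - toR (col j (a_mx E)).
  by rewrite -[in RHS](subrK (delta_mx j 0) y) s_fun_period addrK.
have Ek (k : int) y j :
    s_fun E (y + k%:~R *: delta_mx j 0) = s_fun E y + k%:~R *: toR (col j (a_mx E)).
  elim: k y => [|k IH|k IH] y; first by rewrite !scale0r !addr0.
    by rewrite -(addn1 k) PoszD intrD !scalerDl !scale1r !addrA s_fun_period IH.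
  by rewrite -(addn1 k) PoszD opprD intrD !scalerDl !scaleN1r !addrA E1 IH.
have vE : toR v = \sum_j (v j 0)%:~R *: delta_mx j 0 :> 'cV[R]_n.
  rewrite {1}[toR v]matrix_sum_delta; apply: eq_bigr => j _.
  by rewrite big_ord1 mxE.
have avE : toR (a_mx E *m v) = \sum_j (v j 0)%:~R *: toR (col j (a_mx E)).
  apply/matrixP => i k; rewrite ord1 summxE !mxE rmorph_sum /=.
  by apply: eq_bigr => j _; rewrite !mxE rmorphM mulrC.
rewrite vE avE; elim/big_ind2: _ x => [x||j _ x].
- by rewrite !addr0.
- by move=> a b a' b' Ha Hb x; rewrite !addrA Hb Ha.
- exact: Ek.
Qed.

(* nabla^tau is always a twisted connection, so that the first half of
   twisted_integrable is not a restriction on objects. *)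
Lemma omega_twisted (T : 'M[C]_n) (tau : 'M[R]_n) (eps : R) (E : bundle_data R n) :
  twisted_connection T eps (flat_gerbe T tau) (trans E) (omega T tau E).
Proof.
move=> b c v w p _ /=.
pose cv : 'rV[R]_(n + n) := row_mx 0 (- (2 * pi) *: (toR (a_mx E *m v))^T).
have transE p' : trans E b c v w p' = cis ((cv *m p') 0 0).
  rewrite /trans -[p' in RHS]vsubmxK mul_row_col mul0mx add0r -scalemxAl.
  by rewrite [in RHS]mxE mulNr.
have -> : trans E b c v w = fun p' => cis ((cv *m p') 0 0) by exact/funext.
rewrite /dext.
under eq_bigr do rewrite !partial_scalar !wedge_blade0 !Cderive_cis.
have nz := cis_neq0 ((cv *m p) 0 0).
have cvl j : (cv *m (delta_mx (lshift n j) 0 : 'cV[R]__)) 0 0 = 0.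
  by rewrite -(colE (_ : 'I_(n + n)) cv) mxE row_mxEl mxE.
have cvr j : (cv *m (delta_mx (rshift n j) 0 : 'cV[R]__)) 0 0
    = - (2 * pi) * ((a_mx E *m v) j 0)%:~R.
  by rewrite -(colE (_ : 'I_(n + n)) cv) mxE row_mxEr !mxE.
have form1D (u u' : 'rV[C]_n) eta :
    form1 (u + u') eta = form1 u eta + form1 u' eta.
  by rewrite /form1 -big_split; apply: eq_bigr => j _; rewrite mxE scalerDl.
rewrite [(cis _)^-1 *: _](_ : _ = - (2 * pi%:C * 'i%C) *:
    form1 (toC (toR (a_mx E *m v)))^T (dy T)); last first.
  rewrite scaler_sumr /form1 scaler_sumr; apply: eq_bigr => j _.
  rewrite cvl cvr mulr0 mul0r scale0r add0r scalerA mulrC mulfK// scalerA !mxE.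
  congr (_ *: _); set N : R := _%:~R; move: N (pi : R) => N q.
  by rewrite (rmorphM (real_complex R)) rmorphN rmorphM rmorph_nat; ring.
have xs : xcoord (shift2 v w p) = xcoord p + toR v.
  have H := col_mxKu (toR v) (toR w).
  by apply/matrixP => i k; rewrite -H !mxE.
rewrite /omega xs s_fun_shift.
move: (xcoord p) => x.
have -> : (toC (s_fun E x + toR (a_mx E *m v)))^T =
    (toC (s_fun E x))^T + (toC (toR (a_mx E *m v)))^T.
  by apply/matrixP => i k; rewrite !mxE rmorphD.
have -> : toC ((x + toR v)^T *m tau) = toC (x^T *m tau) + toC ((toR v)^T *m tau).
  by rewrite (linearD trmx) mulmxDl map_mxD.
have zmod_eq (a v' x' w' : covec R n) :
    a + v' - (x' + w') - (a - x' + v') = - w'.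
  by rewrite opprD addrA (addrAC a v') [_ - w' - _]addrAC subrr sub0r.
rewrite ['i%C * _]mulrC (addrAC (toC (s_fun E x))^T).
rewrite (form1D (_ + _) (toC (toR (a_mx E *m v)))^T) (form1D (toC (x^T *m tau))).
move: (form1 _ (dy T)) (form1 _ (dy T)) (form1 _ (dx T)) (form1 _ (dx T)) => P Q X W.
by rewrite (scalerDr _ Q) (scalerDr _ W) zmod_eq scaleNr.
Qed.
End WellDefined.

(* Main.v *)
Require Import Defs.
From mathcomp Require Import all_boot all_order all_algebra.
From mathcomp Require Import complex ring lra.
From mathcomp Require Import all_classical all_reals all_analysis.
Import Order.TTheory GRing.Theory Num.Theory numFieldNormedType.Exports.

Set Implicit Arguments.
Unset Strict Implicit.
Unset Printing Implicit Defensive.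

Local Open Scope ring_scope.
Local Open Scope complex_scope.

(* On forms of type (0, r) the operator dbar is delbar phi = sum_i theta_i /\ d_i phi, where
   theta_i is the (0, 1)-part of the i-th coordinate differential, and the differential of
   Hom(E1, E2) becomes phi |-> delbar phi + alpha /\ phi with alpha = (omega_2 - omega_1)^(0,1).
   By Schwarz's theorem delbar squares to zero, so that the square of the differential is
   multiplication by delbar alpha = Omega_2^(0,2) - Omega_1^(0,2): the 1-connection of the
   gerbe cancels, and both terms vanish by integrability. Likewise the 0-connection of the
   gerbe cancels in alpha, which therefore changes between charts by the logarithmic
   derivatives of the ordinary transition functions; this makes the differential compatible
   with them. The Leibniz rule is the graded commutativity of the wedge product together
   with omega_3 - omega_1 = (omega_3 - omega_2) + (omega_2 - omega_1). *)

(** * Exterior algebra *)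

Section ExteriorAlgebra.
Variables (K : comNzRingType) (k : nat).
Implicit Types (u v w : ext K k) (A B C X Y Z : {set 'I_k}).

(** As a double sum over pairs, the number of inversions is additive over disjoint unions in each
    argument, which is what associativity of the wedge rests on. *)
Lemma inversionsE A B :
  inversions A B = (\sum_(i in A) \sum_(j in B) (j < i)%N)%N.
Proof.
rewrite /inversions -sum1dep_card pair_big_dep /= big_mkcond [RHS]big_mkcond /=.
apply: eq_bigr => -[i j] _ /=.
by case: (i \in A) => //=; case: (j \in B) => //=.
Qed.

Lemma big_disjointU (F : 'I_k -> nat) X Y : [disjoint X & Y] ->
  (\sum_(i in X :|: Y) F i = \sum_(i in X) F i + \sum_(i in Y) F i)%N.
Proof. by move=> dXY; rewrite -bigU //; apply: eq_bigl => i; rewrite !inE. Qed.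

Lemma inversionsUl X Y Z : [disjoint X & Y] ->
  inversions (X :|: Y) Z = (inversions X Z + inversions Y Z)%N.
Proof. by move=> dXY; rewrite !inversionsE big_disjointU. Qed.

Lemma inversionsUr X Y Z : [disjoint Y & Z] ->
  inversions X (Y :|: Z) = (inversions X Y + inversions X Z)%N.
Proof.
move=> dYZ; rewrite !inversionsE -big_split /=.
by apply: eq_bigr => i _; rewrite big_disjointU.
Qed.

(** Each pair is inverted in exactly one of the two orders, since disjointness excludes equal
    members. This is the source of the sign $(-1)^{rs}$ in [wedgeC]. *)
Lemma inversionsC A B : [disjoint A & B] ->
  (inversions A B + inversions B A)%N = (#|A| * #|B|)%N.
Proof.
move=> dAB; rewrite !inversionsE [X in (_ + X)%N]exchange_big -big_split /=.
rewrite -sum_nat_const; apply: eq_bigr => i iA.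
rewrite -big_split -sum1_card /=; apply: eq_bigr => j jB.
case: ltngtP => // /val_inj ij.
by have := disjointFr dAB iA; rewrite -ij jB.
Qed.

Lemma wedgeE u v C : wedge u v C =
  \sum_(A : {set 'I_k} | A \subset C)
     (-1) ^+ inversions A (C :\: A) * (u A : K) * (v (C :\: A) : K).
Proof. by rewrite ffunE. Qed.

Lemma wedge_linearl (c : K) u u' v :
  wedge (c *: u + u') v = c *: wedge u v + wedge u' v.
Proof.
apply/ffunP => C; rewrite !ffunE scaler_sumr -big_split /=.
apply: eq_bigr => A _; rewrite !ffunE.
have E (s a b d : K) : s * (c * a + b) * d = c * (s * a * d) + s * b * d by ring.
exact: E.
Qed.

Lemma wedge_linearr (c : K) u v v' :
  wedge u (c *: v + v') = c *: wedge u v + wedge u v'.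
Proof.
apply/ffunP => C; rewrite !ffunE scaler_sumr -big_split /=.
apply: eq_bigr => A _; rewrite !ffunE.
have E (s a b d : K) : s * d * (c * a + b) = c * (s * d * a) + s * d * b by ring.
exact: E.
Qed.

Lemma wedgeDl u u' v : wedge (u + u') v = wedge u v + wedge u' v.
Proof. by rewrite -[u]scale1r wedge_linearl !scale1r. Qed.

Lemma wedgeDr u v v' : wedge u (v + v') = wedge u v + wedge u v'.
Proof. by rewrite -[v]scale1r wedge_linearr !scale1r. Qed.

Lemma wedge0l v : wedge 0 v = 0.
Proof. by apply: (addrI (wedge 0 v)); rewrite -wedgeDl !addr0. Qed.

Lemma wedge0r u : wedge u 0 = 0.
Proof. by apply: (addrI (wedge u 0)); rewrite -wedgeDr !addr0. Qed.

Lemma wedgeZl (c : K) u v : wedge (c *: u) v = c *: wedge u v.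
Proof. by rewrite -[c *: u]addr0 wedge_linearl wedge0l addr0. Qed.

Lemma wedgeZr (c : K) u v : wedge u (c *: v) = c *: wedge u v.
Proof. by rewrite -[c *: v]addr0 wedge_linearr wedge0r addr0. Qed.

Lemma wedgeNl u v : wedge (- u) v = - wedge u v.
Proof. by rewrite -scaleN1r wedgeZl scaleN1r. Qed.

Lemma wedge_suml (I : Type) (r : seq I) (P : pred I) (F : I -> ext K k) v :
  wedge (\sum_(i <- r | P i) F i) v = \sum_(i <- r | P i) wedge (F i) v.
Proof.
exact: (big_morph (fun u => wedge u v) (fun u u' => wedgeDl u u' v) (wedge0l v)).
Qed.

Lemma wedge_sumr (I : Type) (r : seq I) (P : pred I) (F : I -> ext K k) u :
  wedge u (\sum_(i <- r | P i) F i) = \sum_(i <- r | P i) wedge u (F i).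
Proof.
exact: (big_morph (fun v => wedge u v) (wedgeDr u) (wedge0r u)).
Qed.

Lemma wedge_eq0 u v C :
  (forall A, A \subset C -> u A = 0 \/ v (C :\: A) = 0) -> wedge u v C = 0.
Proof.
move=> uv0; rewrite wedgeE big1 // => A sAC.
by case: (uv0 A sAC) => ->; rewrite ?mulr0 ?mul0r.
Qed.

Lemma wedge1r u : wedge u (blade K finset.set0) = u.
Proof.
apply/ffunP => C; rewrite wedgeE (bigD1 C) //= finset.setDv !ffunE eqxx mulr1.
rewrite inversionsE big1 ?expr0 ?mul1r; last by move=> i _; rewrite big_set0.
rewrite big1 ?addr0 // => A /andP[sAC AneC].
rewrite !ffunE finset.setD_eq0; case: (boolP (C \subset A)) => [CA|]; last by rewrite mulr0.
by case/eqP: AneC; apply/eqP; rewrite finset.eqEsubset sAC.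
Qed.

Lemma wedge1l u : wedge (blade K finset.set0) u = u.
Proof.
apply/ffunP => C; rewrite wedgeE (bigD1 finset.set0) ?finset.sub0set //= finset.setD0 !ffunE eqxx.
rewrite inversionsE big_set0 expr0 !mul1r big1 ?addr0 // => A /andP[_ /negPf A0].
by rewrite !ffunE A0 mulr0 mul0r.
Qed.

(** Both sides sum over the partitions of [C] into three ordered blocks, and both signs count the
    inversions between the three pairs of blocks. *)
Lemma wedgeA u v w : wedge u (wedge v w) = wedge (wedge u v) w.
Proof.
apply/ffunP => C; rewrite !wedgeE.
under eq_bigr do rewrite wedgeE mulr_sumr.
under [RHS]eq_bigr do rewrite wedgeE mulr_sumr mulr_suml.
rewrite [RHS](exchange_big_dep (fun A : {set 'I_k} => A \subset C)) /=; last first.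
  by move=> B A BC AB; exact: fintype.subset_trans AB BC.
apply: eq_bigr => A sAC.
(* The sets [D] of the left sum lie in [C :\: A], the sets [B] of the right sum between [A] and [C];
   they correspond by [B = A :|: D]. *)
rewrite (reindex_onto (fun B => B :\: A) (fun D => A :|: D)) /=; last first.
  move=> D; rewrite finset.subsetD => /andP[_]; rewrite fintype.disjoint_sym => AD.
  by rewrite finset.setDUl finset.setDv finset.set0U (finset.setDidPl _) 1?fintype.disjoint_sym.
apply: eq_big => [B|B /andP[]].
  have -> : (A :|: B :\: A == B) = (A \subset B).
    apply/eqP/idP => [<-|AB]; first exact: finset.subsetUl.
    by rewrite -[RHS](finset.setID _ A) (finset.setIidPr AB).
  case: (boolP (A \subset B)) => AB; rewrite ?andbT ?andbF //.
  rewrite finset.subsetD finset.subDset (finset.setUidPr sAC).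
  by rewrite finset.disjoints_subset finset.setDE finset.subsetIr andbT.
move=> BAC /eqP ABE.
have AB : A \subset B by rewrite -ABE finset.subsetUl.
have BC : B \subset C.
  by rewrite -ABE finset.subUset sAC; move: BAC; rewrite finset.subsetD => /andP[].
rewrite finset.setDDl ABE.
have CA : C :\: A = (B :\: A) :|: (C :\: B).
  apply/finset.setP => i; rewrite !inE.
  have := fintype.subsetP AB i; have := fintype.subsetP BC i.
  by case: (i \in A); case: (i \in B); case: (i \in C) => // h h';
    first [have := h isT | have := h' isT].
have dl : [disjoint B :\: A & C :\: B].
  by apply/pred0P => i /=; rewrite !inE; case: (i \in B); rewrite ?andbF.
have dr : [disjoint A & B :\: A].
  by apply/pred0P => i /=; rewrite !inE; case: (i \in A).
have -> : inversions B (C :\: B)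
    = (inversions A (C :\: B) + inversions (B :\: A) (C :\: B))%N.
  by rewrite -inversionsUl // ABE.
by rewrite CA inversionsUr // !exprD; ring.
Qed.

(** Total degree only, without the splitting into types: graded commutativity depends on nothing
    finer. *)
Definition homogeneous (r : nat) u := forall A, #|A| != r -> u A = 0.

Lemma homogeneous_linear r (c : K) u v :
  homogeneous r u -> homogeneous r v -> homogeneous r (c *: u + v).
Proof. by move=> hu hv A Ar; rewrite !ffunE hu // hv // [c *: _]mulr0 addr0. Qed.

Lemma homogeneous0 r : homogeneous r 0.
Proof. by move=> A _; rewrite ffunE. Qed.

Lemma homogeneousD r u v :
  homogeneous r u -> homogeneous r v -> homogeneous r (u + v).
Proof. by rewrite -{2}[u]scale1r; apply: homogeneous_linear. Qed.

Lemma homogeneousZ r (c : K) u : homogeneous r u -> homogeneous r (c *: u).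
Proof.
by move=> hu; rewrite -[c *: u]addr0; apply: homogeneous_linear (@homogeneous0 r).
Qed.

Lemma homogeneous_sum r (I : Type) (s : seq I) (P : pred I) (F : I -> ext K k) :
  (forall i, P i -> homogeneous r (F i)) -> homogeneous r (\sum_(i <- s | P i) F i).
Proof.
move=> hF; elim/big_rec: _ => [|i u Pi hu]; first exact: homogeneous0.
exact: homogeneousD (hF i Pi) hu.
Qed.

Lemma homogeneous_blade A : homogeneous #|A| (blade K A).
Proof. by move=> B; rewrite ffunE; case: (B =P A) => [->|//]; rewrite eqxx. Qed.

(** Complementation inside [C] exchanges the two factors. In a nonzero term the blocks have sizes
    [r] and [s], so that [inversionsC] compares the two signs. *)
Lemma wedgeC r s u v : homogeneous r u -> homogeneous s v ->
  wedge u v = (-1) ^+ (r * s) *: wedge v u.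
Proof.
move=> hu hv; apply/ffunP => C; rewrite [RHS]ffunE !wedgeE scaler_sumr.
have DK (A : {set 'I_k}) : A \subset C -> C :\: (C :\: A) = A.
  by move=> sAC; rewrite finset.setDDr finset.setDv finset.set0U (finset.setIidPr sAC).
rewrite (reindex_onto (fun A => C :\: A) (fun A => C :\: A)) /=; last exact: DK.
apply: eq_big => [A|A /andP[_ /eqP CA]].
  by rewrite finset.subsetDl; apply/eqP/idP => [<-|]; [exact: finset.subsetDl|exact: DK].
rewrite CA.
have [Ar|/hv ->] := eqVneq #|A| s; last first.
  by rewrite !mulr0 mul0r scaler0.
have [CAr|/hu ->] := eqVneq #|C :\: A| r; last first.
  by rewrite !mulr0 mul0r scaler0.
have dA : [disjoint C :\: A & A].
  by apply/pred0P => i /=; rewrite !inE; case: (i \in A); rewrite ?andbF.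
have := inversionsC dA; rewrite Ar CAr => <-.
(* Inserting the square of the opposite sign [a] yields [b * a], the total sign computed by
   [inversionsC]. *)
have E (a b x y : K) : a * a = 1 -> b * x * y = (b * a) * (a * y * x).
  by move=> aa; transitivity (a * a * (b * x * y)); [rewrite aa mul1r|ring].
rewrite exprD; apply: (E ((-1) ^+ inversions A (C :\: A)) ((-1) ^+ inversions (C :\: A) A)).
by rewrite -expr2 sqrr_sign.
Qed.

End ExteriorAlgebra.

(** * Bidegrees of forms *)

Section TypeDecomposition.
Variables (R : realType) (n : nat).
Local Notation C := R[i].
Implicit Types (u v w : covec R n) (A B : {set 'I_(n + n)}).

(** In the coframe of [covec] the left indices are the $dz_j$ and the right ones the $d\bar z_j$, so
    [(ltype A, rtype A)] is the bidegree of the blade of [A]. *)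
Definition ltype A := #|[set j | lshift n j \in A]%SET|.
Definition rtype A := #|[set j | rshift n j \in A]%SET|.

Lemma type_partE a b u A :
  type_part a b u A = if (ltype A == a) && (rtype A == b) then u A else 0.
Proof. by rewrite ffunE. Qed.

Lemma ltypeD A B : A \subset B -> ltype B = (ltype A + ltype (B :\: A))%N.
Proof.
move=> AB; rewrite /ltype -(cardsID [set j | lshift n j \in A]%SET); congr (_ + _)%N.
  by apply: eq_card => j; rewrite !inE andbC;
     case: (boolP (_ \in A)) => // /(fintype.subsetP AB) ->.
by apply: eq_card => j; rewrite !inE.
Qed.

Lemma rtypeD A B : A \subset B -> rtype B = (rtype A + rtype (B :\: A))%N.
Proof.
move=> AB; rewrite /rtype -(cardsID [set j | rshift n j \in A]%SET); congr (_ + _)%N.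
  by apply: eq_card => j; rewrite !inE andbC;
     case: (boolP (_ \in A)) => // /(fintype.subsetP AB) ->.
by apply: eq_card => j; rewrite !inE.
Qed.

Lemma card_type A : #|A| = (ltype A + rtype A)%N.
Proof.
rewrite -sum1_card big_mkcond big_split_ord /= -!big_mkcond /= /ltype /rtype.
by rewrite -!sum1_card; congr (_ + _)%N; apply: eq_bigl => j; rewrite inE.
Qed.

Lemma type_part_linear a b (c : C) u v :
  type_part a b (c *: u + v) = c *: type_part a b u + type_part a b v.
Proof.
apply/ffunP => A; rewrite !ffunE; case: ifP => // _.
by rewrite [c *: 0]mulr0 addr0.
Qed.

Lemma type_part0 a b : type_part a b (0 : covec R n) = 0.
Proof. by apply/ffunP => A; rewrite !ffunE if_same. Qed.

Lemma type_partD a b u v : type_part a b (u + v) = type_part a b u + type_part a b v.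
Proof. by rewrite -{1}[u]scale1r type_part_linear scale1r. Qed.

Lemma type_partZ a b (c : C) u : type_part a b (c *: u) = c *: type_part a b u.
Proof. by rewrite -[c *: u]addr0 type_part_linear type_part0 addr0. Qed.

Lemma type_partN a b u : type_part a b (- u) = - type_part a b u.
Proof. by rewrite -scaleN1r type_partZ scaleN1r. Qed.

Lemma type_part_sum a b (I : Type) (s : seq I) (P : pred I) (F : I -> covec R n) :
  type_part a b (\sum_(i <- s | P i) F i) = \sum_(i <- s | P i) type_part a b (F i).
Proof. exact: (big_morph (fun u => type_part a b u) (type_partD a b) (type_part0 a b)). Qed.

Lemma of_type_part a b u : of_type a b (type_part a b u).
Proof. by apply/ffunP => A; rewrite !type_partE; case: (ifP) => // ->. Qed.

Lemma of_typeP a b u :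
  of_type a b u <-> forall A, ~~ ((ltype A == a) && (rtype A == b)) -> u A = 0.
Proof.
split=> [<- A /negPf Aab|u0]; first by rewrite type_partE Aab.
by apply/ffunP => A; rewrite type_partE; case: ifPn => // /u0.
Qed.

Lemma of_type_homogeneous a b u : of_type a b u -> homogeneous (a + b) u.
Proof.
move=> /of_typeP u0 A Aab; apply: u0; apply: contra Aab => /andP[/eqP <- /eqP <-].
by rewrite card_type.
Qed.

Lemma of_type0 a b : of_type a b (0 : covec R n).
Proof. exact: type_part0. Qed.

Lemma of_type_linear a b (c : C) u v :
  of_type a b u -> of_type a b v -> of_type a b (c *: u + v).
Proof. by rewrite /of_type type_part_linear => -> ->. Qed.

(** Bidegrees add under the wedge and [v] has a single one, so selecting a bidegree in the product
    amounts to selecting one in [u]. *)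
Lemma wedge_type_partl a b c d u v : of_type c d v ->
  wedge (type_part a b u) v = type_part (a + c) (b + d) (wedge u v).
Proof.
move=> /of_typeP v0; apply/ffunP => A; rewrite type_partE; case: ifPn => Aabcd.
  rewrite !wedgeE; apply: eq_bigr => B BA.
  have [|/v0 ->] := boolP ((ltype (A :\: B) == c) && (rtype (A :\: B) == d));
    last by rewrite !mulr0.
  move=> /andP[/eqP lc /eqP rd]; move: Aabcd.
  rewrite type_partE (ltypeD BA) (rtypeD BA) lc rd !eqn_add2r => /andP[/eqP -> /eqP ->].
  by rewrite !eqxx.
apply: wedge_eq0 => B BA; rewrite type_partE; case: ifPn => [|_]; last by left.
move=> /andP[/eqP la /eqP rb]; right; apply: v0; apply: contra Aabcd.
by rewrite (ltypeD BA) (rtypeD BA) la rb !eqn_add2l.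
Qed.

Lemma of_type_wedge a b c d u v : of_type a b u -> of_type c d v ->
  of_type (a + c) (b + d) (wedge u v).
Proof. by move=> hu hv; rewrite /of_type -wedge_type_partl // hu. Qed.

(** A $dz_j$ in either factor survives in the product, so type (0, 2) only sees the (0, 1)-parts of
    two 1-forms. *)
Lemma type_part02_wedge u v : homogeneous 1%N u -> homogeneous 1%N v ->
  type_part 0 2 (wedge u v) = wedge (type_part 0 1 u) (type_part 0 1 v).
Proof.
move=> hu hv; rewrite (wedge_type_partl 0 1 u (of_type_part 0 1 v)).
apply/ffunP => A; rewrite !type_partE; case: ifP => // /andP[/eqP lA _].
rewrite !wedgeE; apply: eq_bigr => B BA; rewrite type_partE.
have [|/hv ->] := eqVneq #|A :\: B| 1%N; last by rewrite if_same.
move: lA; rewrite card_type (ltypeD BA) => /eqP; rewrite addn_eq0 => /andP[_ /eqP ->].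
by rewrite add0n => ->.
Qed.

End TypeDecomposition.

Local Open Scope classical_set_scope.

(** * Smooth functions *)

Section DirectionalDerivatives.
Variable R : realType.

(** The hypothesis makes the difference quotients of both sides equal as functions of [h], so no
    chain rule enters. Lines, translations and coordinate projections are all covered. *)
Lemma derive_affine (V W : normedModType R) (f : W -> R) (L L0 : V -> W) (p v : V) :
  (forall h : R, L (h *: v + p) = h *: L0 v + L p) ->
  'D_v (fun q => f (L q)) p = 'D_(L0 v) f (L p).
Proof.
move=> LE; rewrite /derive.
apply: (congr1 (fun F : R -> R => lim (F @ 0^')%classic)).
by apply/funext => h /=; rewrite LE.
Qed.

Lemma derivable_affine (V W : normedModType R) (f : W -> R) (L L0 : V -> W) (p v : V) :
  (forall h : R, L (h *: v + p) = h *: L0 v + L p) ->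
  derivable f (L p) (L0 v) -> derivable (fun q => f (L q)) p v.
Proof.
move=> LE df; rewrite /derivable.
rewrite (_ : (fun h => _) = (fun h => h^-1 *: ((f \o shift (L p)) (h *: L0 v) - f (L p)))) //.
by apply/funext => h /=; rewrite LE.
Qed.

Variable V : normedModType R.
Implicit Types (f : V -> R) (p v w : V).

(** Restriction to a line, where the mean value theorem in one real variable applies. *)
Lemma is_derive_line f p v (t : R) : derivable f (p + t *: v) v ->
  is_derive t 1 (fun s : R => f (p + s *: v)) ('D_v f (p + t *: v)).
Proof.
have LE (h : R) : p + (h *: (1 : R) + t) *: v = h *: ((1 : R) *: v) + (p + t *: v).
  by rewrite scale1r scalerDl addrCA [h *: 1]mulr1.
move=> df; apply: DeriveDef.
  by apply: (derivable_affine (L0 := fun s : R => s *: v) LE); rewrite scale1r.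
by rewrite (derive_affine (L0 := fun s : R => s *: v) f LE) scale1r.
Qed.

Lemma MVT_line f p v (h : R) : 0 < h ->
  (forall t, 0 <= t <= h -> derivable f (p + t *: v) v) ->
  exists2 t, 0 <= t <= h & f (p + h *: v) - f p = 'D_v f (p + t *: v) * h.
Proof.
move=> h0 df.
have [||t] := @MVT R (fun s => f (p + s *: v)) (fun t => 'D_v f (p + t *: v)) 0 h h0.
- move=> t; rewrite in_itv /= => /andP[/ltW t0 /ltW th].
  by apply: is_derive_line; apply: df; rewrite t0.
- apply: derivable_within_continuous => t; rewrite in_itv /= => tI.
  by have [] := is_derive_line (df t tI).
rewrite in_itv /= scale0r addr0 subr0 => /andP[/ltW t0 /ltW th] ->.
by exists t; rewrite ?t0.
Qed.

(** The mean value theorem is applied twice: to [q |-> f (q + h *: w) - f q] along [v], then to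
    ['D_v f] along [w]. *)
Lemma double_difference f p v w (h : R) : 0 < h ->
  (forall s t, 0 <= s <= h -> 0 <= t <= h ->
    derivable f (p + s *: v + t *: w) v /\
    derivable ('D_v f) (p + s *: v + t *: w) w) ->
  exists s t, [/\ 0 <= s <= h, 0 <= t <= h &
    f (p + h *: v + h *: w) - f (p + h *: v) - f (p + h *: w) + f p =
    'D_w ('D_v f) (p + s *: v + t *: w) * h * h].
Proof.
move=> h0 df.
have hh : 0 <= h <= h by rewrite lexx ltW.
have h00 : 0 <= (0 : R) <= h by rewrite lexx ltW.
pose F q := f (q + h *: w) - f q.
have LE q (e : R) : e *: v + q + h *: w = e *: v + (q + h *: w) by rewrite addrA.
have dF s : 0 <= s <= h -> is_derive (p + s *: v) v F
    ('D_v f (p + s *: v + h *: w) - 'D_v f (p + s *: v)).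
  move=> sh.
  have := (df s h sh hh).1; have := (df s 0 sh h00).1; rewrite scale0r addr0 => d0 dh.
  apply: is_deriveB; last exact: DeriveDef.
  apply: DeriveDef; first exact: (derivable_affine (L0 := id) (LE _)).
  exact: (derive_affine (L0 := id) f (LE _)).
have [|s sh E] := @MVT_line F p v h h0; first by move=> t /dF[].
have [|t th E'] := @MVT_line ('D_v f) (p + s *: v) w h h0.
  by move=> t th; have [] := df s t sh th.
exists s, t; split=> //; rewrite -E' -(@derive_val _ _ _ _ _ _ _ (dF s sh)) -E /F.
by ring.
Qed.

(** The nearby points [q] and [q'] may differ, because the mean value theorem gives different
    intermediate points for the two orders of differentiation. *)
Lemma continuous_eq_at (A B : V -> R) p :
  {for p, continuous A} -> {for p, continuous B} ->
  (forall d, 0 < d -> exists q q', [/\ ball p d q, ball p d q' & A q = B q']) ->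
  A p = B p.
Proof.
move=> cA cB AB; apply/eqP; rewrite -subr_eq0 -normr_le0; apply/ler_addgt0Pl => e e0.
rewrite addr0.
have e2 : 0 < e / 2 by rewrite divr_gt0.
have /cvgrPdist_lt/(_ _ e2)/nbhs_ballP[dA /= dA0 nA] := cA.
have /cvgrPdist_lt/(_ _ e2)/nbhs_ballP[dB /= dB0 nB] := cB.
have [|q [q' [pq pq' Aq]]] := AB (Num.min dA dB); first by rewrite lt_min dA0.
have /nA Aq2 : ball p dA q by apply: le_ball pq; rewrite ge_min lexx.
have /nB Bq2 : ball p dB q' by apply: le_ball pq'; rewrite ge_min lexx orbT.
apply/ltW/(le_lt_trans (ler_distD (A q) _ _)).
by rewrite [ltRHS](splitr e) ltrD // Aq distrC.
Qed.

(* Schwarz's theorem: near p the same second difference is a value of either mixed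
   derivative times h ^+ 2. *)
Lemma derive_comm f p v w :
  (\forall q \near p, [/\ derivable f q v, derivable f q w,
     derivable ('D_v f) q w & derivable ('D_w f) q v]) ->
  {for p, continuous ('D_w ('D_v f))} -> {for p, continuous ('D_v ('D_w f))} ->
  'D_w ('D_v f) p = 'D_v ('D_w f) p.
Proof.
move=> /nbhs_ballP[d0 /= d00 near_p] cvw cwv; apply: continuous_eq_at cvw cwv _ => d1 d10.
pose d := Num.min d0 d1.
have d_gt0 : 0 < d by rewrite lt_min d00.
have dd0 : d <= d0 by rewrite ge_min lexx.
have dd1 : d <= d1 by rewrite ge_min lexx orbT.
(* The parallelogram with sides [h *: v] and [h *: w] has to fit in the ball of radius [d]: its
   points are at distance at most [h * N = d / 2] from [p]. The summand 1 keeps [N] positive when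
   both vectors vanish. *)
pose N := `|v| + `|w| + 1.
have N0 : 0 < N by rewrite /N; have := normr_ge0 v; have := normr_ge0 w; lra.
pose h := d / 2 / N.
have h0 : 0 < h by rewrite !divr_gt0.
have inB s t : 0 <= s <= h -> 0 <= t <= h -> ball p d (p + s *: v + t *: w).
  move=> /andP[s0 sh] /andP[t0 th]; rewrite -ball_normE /= -addrA opprD addNKr normrN.
  have le_hN : `|s *: v + t *: w| <= h * N.
    rewrite (le_trans (ler_normD _ _)) // !normrZ !ger0_norm //.
    have := ler_wpM2r (normr_ge0 v) sh; have := ler_wpM2r (normr_ge0 w) th.
    by rewrite /N; lra.
  apply: le_lt_trans le_hN _; rewrite /h divfK ?gt_eqF //.
  by rewrite ltr_pdivrMr // ltr_pMr // ltr1n.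
have [s [t [sh th E]]] : exists s t, [/\ 0 <= s <= h, 0 <= t <= h &
    f (p + h *: v + h *: w) - f (p + h *: v) - f (p + h *: w) + f p =
    'D_w ('D_v f) (p + s *: v + t *: w) * h * h].
  apply: (double_difference h0) => s t sh th.
  have [dv _ dvw _] := near_p _ (le_ball dd0 (inB _ _ sh th)).
  exact: conj dv dvw.
have [s' [t' [sh' th' E']]] : exists s t, [/\ 0 <= s <= h, 0 <= t <= h &
    f (p + h *: w + h *: v) - f (p + h *: w) - f (p + h *: v) + f p =
    'D_v ('D_w f) (p + s *: w + t *: v) * h * h].
  apply: (double_difference h0) => s' t' sh' th'; rewrite addrAC.
  have [_ dw _ dwv] := near_p _ (le_ball dd0 (inB _ _ th' sh')).
  exact: conj dw dwv.
exists (p + s *: v + t *: w), (p + s' *: w + t' *: v); split.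
- exact: le_ball dd1 _ (inB _ _ sh th).
- by rewrite addrAC; exact: le_ball dd1 _ (inB _ _ th' sh').
have hn0 : h != 0 by rewrite gt_eqF.
apply: (mulIf hn0); apply: (mulIf hn0); apply: (etrans (esym E)); apply: etrans E'.
by rewrite (addrAC p (h *: w)); ring.
Qed.
End DirectionalDerivatives.

(** * Closure properties of smooth real functions *)

Section SmoothFunctions.
Variables (R : realType) (m : nat).
Local Notation V := 'cV[R]_m.
Local Notation e_ i := (delta_mx i 0 : V).
Implicit Types (U : set V) (f g : V -> R).

Lemma open_near U p (P : V -> Prop) : open U -> U p -> (forall q, U q -> P q) ->
  \forall q \near p, P q.
Proof. by move=> Uo Up UP; apply: filterS UP _; exact: open_nbhs_nbhs. Qed.

(** On an open set, equality at every point is equality near every point, hence passes to the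
    derivatives at each level. *)
Lemma Ck_eq k U f g : open U -> (forall p, U p -> f p = g p) -> Ck k U f -> Ck k U g.
Proof.
move=> Uo; elim: k f g => [|k IH] f g fg /= fC.
  move=> p Up; have fg' : \forall q \near p, f q = g q := open_near Uo Up fg.
  rewrite /prop_for /continuous_at -(fg p Up).
  exact: cvg_trans (near_eq_cvg fg') (fC p Up).
move=> i; have [df Cf] := fC i; split.
  move=> p Up; have nfg : \forall q \near p, f q = g q := open_near Uo Up fg.
  exact: near_eq_derivable nfg (df p Up).
apply: IH Cf => p Up; have nfg : \forall q \near p, f q = g q := open_near Uo Up fg.
exact: near_eq_derive nfg.
Qed.

Lemma smooth_eq U f g : open U -> (forall p, U p -> f p = g p) -> smooth U f -> smooth U g.
Proof. by move=> Uo fg fs k; apply: Ck_eq Uo fg (fs k). Qed.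

Lemma smooth_derivable U f p i : smooth U f -> U p -> derivable f p (e_ i).
Proof. by move=> /(_ 1%N) /(_ i)[+ _] => /[apply]. Qed.

Lemma smooth_derive U f i : smooth U f -> smooth U ('D_(e_ i) f).
Proof. by move=> fs k; have [] := fs k.+1 i. Qed.

Lemma smooth_continuous U f p : smooth U f -> U p -> {for p, continuous f}.
Proof. by move=> /(_ 0%N); apply. Qed.

Lemma smooth_subset U U' f : U' `<=` U -> smooth U f -> smooth U' f.
Proof.
move=> U'U fs k; elim: k f fs => [|k IH] f fs /=.
  by move=> p /U'U; apply: smooth_continuous.
move=> i; split; first by move=> p /U'U; apply: smooth_derivable.
by apply: IH; apply: smooth_derive.
Qed.

Lemma Ck_cst k U (c : R) : Ck k U (fun=> c).
Proof.
elim: k c => [|k IH] c /=; first by move=> p _; exact: (@cst_continuous V R c p).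
move=> i; split; first by move=> p _; exact: derivable_cst.
suff -> : (fun p : V => 'D_(e_ i) (fun=> c) p) = (fun=> 0) by exact: IH.
by apply/funext => p; exact: derive_cst.
Qed.

Lemma smooth_cst U (c : R) : smooth U (fun=> c).
Proof. by move=> k; exact: Ck_cst. Qed.

Lemma CkD k U f g : open U -> Ck k U f -> Ck k U g -> Ck k U (fun p => f p + g p).
Proof.
move=> Uo; elim: k f g => [|k IH] f g /= fC gC.
  by move=> p Up; apply: (continuousD (fC p Up) (gC p Up)).
move=> i; have [df Cf] := fC i; have [dg Cg] := gC i; split.
  by move=> p Up; apply: derivableD; [exact: df|exact: dg].
apply: Ck_eq Uo _ (IH _ _ Cf Cg) => p Up.
by rewrite -deriveD //; [exact: df|exact: dg].
Qed.

Lemma smoothD U f g : open U -> smooth U f -> smooth U g -> smooth U (fun p => f p + g p).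
Proof. by move=> Uo fs gs k; exact: CkD. Qed.

(** The induction carries full smoothness of both factors: the product rule involves [f] and [g]
    undifferentiated at level [k], whereas [Ck k.+1] by definition gives level [k] only for the
    derivatives. *)
Lemma smoothM U f g : open U -> smooth U f -> smooth U g -> smooth U (fun p => f p * g p).
Proof.
move=> Uo + + k; elim: k f g => [|k IH] f g fs gs /=.
  by move=> p Up; apply: (continuousM (smooth_continuous fs Up) (smooth_continuous gs Up)).
move=> i; split.
  by move=> p Up; apply: derivableM; [exact: smooth_derivable fs Up|exact: smooth_derivable gs Up].
apply: Ck_eq Uo _ (CkD Uo (IH _ _ fs (smooth_derive i gs)) (IH _ _ gs (smooth_derive i fs))).
move=> p Up; apply/esym/deriveM; [exact: smooth_derivable fs Up|exact: smooth_derivable gs Up].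
Qed.

Lemma smooth_derive_comm U f i j p : open U -> smooth U f -> U p ->
  'D_(e_ i) ('D_(e_ j) f) p = 'D_(e_ j) ('D_(e_ i) f) p.
Proof.
move=> Uo fs Up; apply: derive_comm.
- apply: (open_near Uo Up) => q Uq; split.
  + exact: smooth_derivable fs Uq.
  + exact: smooth_derivable fs Uq.
  + exact: smooth_derivable (smooth_derive j fs) Uq.
  + exact: smooth_derivable (smooth_derive i fs) Uq.
- exact: smooth_continuous (smooth_derive i (smooth_derive j fs)) Up.
- exact: smooth_continuous (smooth_derive j (smooth_derive i fs)) Up.
Qed.

End SmoothFunctions.

(** * Complex-valued functions through their real and imaginary parts *)

Section ComplexFunctions.
Variables (R : realType) (m : nat).
Local Notation V := 'cV[R]_m.
Local Notation C := R[i].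
Local Notation Re := (@complex.Re R).
Local Notation Im := (@complex.Im R).
Local Notation e_ i := (delta_mx i 0 : V).
Implicit Types (U : set V) (f g : V -> C) (p v : V).

Lemma ReD (x y : C) : Re (x + y) = Re x + Re y. Proof. by case: x y => ? ? []. Qed.
Lemma ImD (x y : C) : Im (x + y) = Im x + Im y. Proof. by case: x y => ? ? []. Qed.
Lemma ReM (x y : C) : Re (x * y) = Re x * Re y - Im x * Im y.
Proof. by case: x y => ? ? []. Qed.
Lemma ImM (x y : C) : Im (x * y) = Re x * Im y + Im x * Re y.
Proof. by case: x y => ? ? []. Qed.

Lemma Csmooth_eq U f g : open U -> (forall p, U p -> f p = g p) -> Csmooth U f -> Csmooth U g.
Proof.
by move=> Uo fg [fr fi]; split; [apply: smooth_eq fr|apply: smooth_eq fi] => // p /fg ->.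
Qed.

Lemma Csmooth_subset U U' f : U' `<=` U -> Csmooth U f -> Csmooth U' f.
Proof. by move=> U'U [fr fi]; split; [exact: smooth_subset fr|exact: smooth_subset fi]. Qed.

Lemma Csmooth_cst U (c : C) : Csmooth U (fun=> c).
Proof. by split; exact: smooth_cst. Qed.

Lemma CsmoothD U f g : open U -> Csmooth U f -> Csmooth U g -> Csmooth U (fun p => f p + g p).
Proof.
move=> Uo [fr fi] [gr gi]; split.
  by under eq_fun do rewrite ReD; exact: smoothD.
by under eq_fun do rewrite ImD; exact: smoothD.
Qed.

Lemma CsmoothM U f g : open U -> Csmooth U f -> Csmooth U g -> Csmooth U (fun p => f p * g p).
Proof.
move=> Uo [fr fi] [gr gi]; split.
  under eq_fun do rewrite ReM -mulN1r mulrA; apply: smoothD => //; first exact: smoothM.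
  by apply: smoothM => //; apply: smoothM => //; exact: smooth_cst.
by under eq_fun do rewrite ImM; apply: smoothD => //; exact: smoothM.
Qed.

Lemma Csmooth_sum U (I : Type) (s : seq I) (P : pred I) (F : I -> V -> C) : open U ->
  (forall i, P i -> Csmooth U (F i)) -> Csmooth U (fun p => \sum_(i <- s | P i) F i p).
Proof.
move=> Uo Fs; elim: s => [|i s IH].
  by under eq_fun do rewrite big_nil; exact: Csmooth_cst.
under eq_fun do rewrite big_cons; case: (boolP (P i)) => [Pi|_] //.
by apply: CsmoothD => //; exact: Fs.
Qed.

Lemma Csmooth_Cderive U f i : Csmooth U f -> Csmooth U (Cderive (e_ i) f).
Proof. by move=> [fr fi]; split; exact: smooth_derive. Qed.

Definition Cderivable f p v :=
  derivable (fun q => Re (f q)) p v /\ derivable (fun q => Im (f q)) p v.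

Lemma Csmooth_Cderivable U f p i : Csmooth U f -> U p -> Cderivable f p (e_ i).
Proof.
by move=> [fr fi] Up; split; [exact: smooth_derivable fr Up|exact: smooth_derivable fi Up].
Qed.

Lemma Cderive_near f g p v : (\forall q \near p, f q = g q) -> Cderive v f p = Cderive v g p.
Proof.
by move=> fg; rewrite /Cderive; apply: (f_equal2 (@Complex R));
   apply: near_eq_derive; apply: filterS fg => q ->.
Qed.

Lemma Cderive_cst (c : C) p v : Cderive v (fun=> c) p = 0.
Proof. by rewrite /Cderive !derive_cst. Qed.

Lemma CderiveD f g p v : Cderivable f p v -> Cderivable g p v ->
  Cderive v (fun q => f q + g q) p = Cderive v f p + Cderive v g p.
Proof.
move=> [fr fi] [gr gi]; rewrite /Cderive.
under eq_fun do rewrite ReD; under [X in _ +i* 'D_ _ X _]eq_fun do rewrite ImD.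
by rewrite !deriveD.
Qed.

Lemma CderivableD f g p v : Cderivable f p v -> Cderivable g p v ->
  Cderivable (fun q => f q + g q) p v.
Proof.
move=> [fr fi] [gr gi]; split.
  by under eq_fun do rewrite ReD; exact: derivableD.
by under eq_fun do rewrite ImD; exact: derivableD.
Qed.

Lemma CderiveM f g p v : Cderivable f p v -> Cderivable g p v ->
  Cderive v (fun q => f q * g q) p = Cderive v f p * g p + f p * Cderive v g p.
Proof.
move=> [fr fi] [gr gi]; rewrite /Cderive.
under eq_fun do rewrite ReM; under [X in _ +i* 'D_ _ X _]eq_fun do rewrite ImM.
rewrite (deriveB (derivableM fr gr) (derivableM fi gi)).
rewrite (deriveD (derivableM fr gi) (derivableM fi gr)).
rewrite (deriveM fr gr) (deriveM fi gi) (deriveM fr gi) (deriveM fi gr) /GRing.scale /=.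
have E (x y z t a b c d : R) :
    (x * c + z * a - (y * d + t * b)) +i* (x * d + t * a + (y * c + z * b))
    = (a +i* b) * (z +i* t) + (x +i* y) * (c +i* d) :> C.
  by apply/eqP; rewrite eq_complex /=; apply/andP; split; apply/eqP; ring.
by rewrite E; congr (_ * _ + _ * _); [case: (g p)|case: (f p)].
Qed.

Lemma CderivableM f g p v : Cderivable f p v -> Cderivable g p v ->
  Cderivable (fun q => f q * g q) p v.
Proof.
move=> [fr fi] [gr gi]; split.
  by under eq_fun do rewrite ReM; exact: (derivableB (derivableM fr gr) (derivableM fi gi)).
by under eq_fun do rewrite ImM; exact: (derivableD (derivableM fr gi) (derivableM fi gr)).
Qed.

Lemma Cderivable_cst (c : C) p v : Cderivable (fun=> c) p v.
Proof. by split; exact: derivable_cst. Qed.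

Lemma CderiveZ (c : C) f p v : Cderivable f p v ->
  Cderive v (fun q => c * f q) p = c * Cderive v f p.
Proof.
by move=> df; rewrite (CderiveM (Cderivable_cst c p v) df) Cderive_cst mul0r add0r.
Qed.

Lemma Cderive_sum (I : Type) (s : seq I) (P : pred I) (F : I -> V -> C) p v :
  (forall i, P i -> Cderivable (F i) p v) ->
  Cderivable (fun q => \sum_(i <- s | P i) F i q) p v /\
  Cderive v (fun q => \sum_(i <- s | P i) F i q) p = \sum_(i <- s | P i) Cderive v (F i) p.
Proof.
move=> dF; elim: s => [|i s [IHd IH]].
  under eq_fun do rewrite big_nil; rewrite big_nil Cderive_cst.
  by split; [exact: Cderivable_cst|].
under eq_fun do rewrite big_cons; rewrite big_cons; case: (boolP (P i)) => [Pi|_].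
  split; first exact: CderivableD (dF i Pi) IHd.
  by rewrite (CderiveD (dF i Pi) IHd) IH.
exact: conj IHd IH.
Qed.

Lemma Cderive_comm U f i j p : open U -> Csmooth U f -> U p ->
  Cderive (e_ i) (Cderive (e_ j) f) p = Cderive (e_ j) (Cderive (e_ i) f) p.
Proof.
move=> Uo [fr fi] Up.
have DD k l : Cderive (e_ k) (Cderive (e_ l) f) p =
    'D_(e_ k) ('D_(e_ l) (fun q => Re (f q))) p +i* 'D_(e_ k) ('D_(e_ l) (fun q => Im (f q))) p.
  reflexivity.
rewrite (DD i j) (DD j i).
by rewrite (smooth_derive_comm i j Uo fr Up) (smooth_derive_comm i j Uo fi Up).
Qed.

End ComplexFunctions.

(** * Affine changes of variables *)

Section AffineChange.
Variables (R : realType) (m m' : nat).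
Variables (L L0 : 'cV[R]_m -> 'cV[R]_m') (p v : 'cV[R]_m).
Hypothesis LE : forall h : R, L (h *: v + p) = h *: L0 v + L p.

Lemma Cderive_affine (f : 'cV[R]_m' -> R[i]) :
  Cderive v (fun q => f (L q)) p = Cderive (L0 v) f (L p).
Proof.
rewrite /Cderive.
by rewrite (derive_affine (fun q => complex.Re (f q)) LE)
           (derive_affine (fun q => complex.Im (f q)) LE).
Qed.

Lemma Cderivable_affine (f : 'cV[R]_m' -> R[i]) :
  Cderivable f (L p) (L0 v) -> Cderivable (fun q => f (L q)) p v.
Proof.
by move=> [fr fi]; split; [exact: (derivable_affine LE fr)|exact: (derivable_affine LE fi)].
Qed.

End AffineChange.

(** * Differential forms *)

Section FormCalculus.
Variables (R : realType) (n : nat).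
Local Notation C := R[i].
Local Notation V := (pt R n).
Local Notation e_ i := (delta_mx i 0 : 'cV[R]_(n + n)).
Implicit Types (U : set V) (phi psi : dform R n) (p q : V) (u : covec R n).

Lemma partial_formE i phi p A :
  partial_form i phi p A = Cderive (e_ i) (fun q => phi q A) p.
Proof. by rewrite ffunE. Qed.

Lemma covecDE (u v : covec R n) A : (u + v) A = u A + v A.
Proof. by rewrite ffunE. Qed.

Lemma covecZE (c : C) u A : (c *: u) A = c * u A.
Proof. by rewrite ffunE. Qed.

Lemma smooth_form_eq U phi psi : open U -> (forall p, U p -> phi p = psi p) ->
  smooth_form U phi -> smooth_form U psi.
Proof. by move=> Uo E sphi A; apply: Csmooth_eq Uo _ (sphi A) => p /E ->. Qed.

Lemma smooth_form_subset U U' phi : U' `<=` U -> smooth_form U phi -> smooth_form U' phi.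
Proof. by move=> U'U sphi A; apply: Csmooth_subset U'U (sphi A). Qed.

Lemma smooth_form_cst U u : smooth_form U (fun=> u).
Proof. by move=> A; exact: Csmooth_cst. Qed.

Lemma smooth_formD U phi psi : open U -> smooth_form U phi -> smooth_form U psi ->
  smooth_form U (fun p => phi p + psi p).
Proof.
by move=> Uo sphi spsi A; under eq_fun do rewrite covecDE; exact: CsmoothD Uo (sphi A) (spsi A).
Qed.

Lemma smooth_form_scale U (f : V -> C) phi : open U -> Csmooth U f -> smooth_form U phi ->
  smooth_form U (fun p => f p *: phi p).
Proof.
by move=> Uo sf sphi A; under eq_fun do rewrite covecZE; exact: CsmoothM Uo sf (sphi A).
Qed.

Lemma smooth_formZ U (c : C) phi : open U -> smooth_form U phi ->
  smooth_form U (fun p => c *: phi p).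
Proof. by move=> Uo; exact: smooth_form_scale Uo (Csmooth_cst U c). Qed.

Lemma smooth_form_linear U (c : C) phi psi : open U -> smooth_form U phi -> smooth_form U psi ->
  smooth_form U (fun p => c *: phi p + psi p).
Proof. by move=> Uo sphi spsi; exact: smooth_formD Uo (smooth_formZ c Uo sphi) spsi. Qed.

Lemma smooth_formB U phi psi : open U -> smooth_form U phi -> smooth_form U psi ->
  smooth_form U (fun p => phi p - psi p).
Proof.
move=> Uo sphi spsi; under eq_fun do rewrite -scaleN1r addrC.
exact: (smooth_form_linear (-1) Uo spsi sphi).
Qed.

Lemma smooth_form_sum U (I : Type) (s : seq I) (P : pred I) (F : I -> dform R n) : open U ->
  (forall i, P i -> smooth_form U (F i)) -> smooth_form U (fun p => \sum_(i <- s | P i) F i p).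
Proof.
move=> Uo sF; elim: s => [|i s IH].
  by under eq_fun do rewrite big_nil; exact: smooth_form_cst.
under eq_fun do rewrite big_cons; case: (boolP (P i)) => [Pi|_]; last exact: IH.
exact: smooth_formD Uo (sF i Pi) IH.
Qed.

Lemma smooth_form_wedge U phi psi : open U -> smooth_form U phi -> smooth_form U psi ->
  smooth_form U (fun p => wedge (phi p) (psi p)).
Proof.
move=> Uo sphi spsi A; under eq_fun do rewrite wedgeE.
apply: (@Csmooth_sum R _ U _ (index_enum _) (fun B : {set 'I_(n + n)} => B \subset A)
  (fun B p => (-1) ^+ inversions B (A :\: B)%SET * (phi p B : C) * (psi p (A :\: B)%SET : C)) Uo).
move=> B _; apply: (CsmoothM Uo _ (spsi _)).
exact: CsmoothM Uo (Csmooth_cst U _) (sphi B).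
Qed.

Lemma smooth_form_type_part U a b phi : smooth_form U phi ->
  smooth_form U (fun p => type_part a b (phi p)).
Proof.
move=> sphi A; under eq_fun do rewrite type_partE.
by case: ((ltype A == a) && (rtype A == b)); [exact: sphi|exact: Csmooth_cst].
Qed.

Lemma smooth_partial_form U i phi : smooth_form U phi -> smooth_form U (partial_form i phi).
Proof.
by move=> sphi A; under eq_fun do rewrite partial_formE; exact: Csmooth_Cderive (sphi A).
Qed.

Lemma partial_form_eq U i phi psi p : open U -> U p -> (forall q, U q -> phi q = psi q) ->
  partial_form i phi p = partial_form i psi p.
Proof.
move=> Uo Up E; apply/ffunP => A; rewrite !partial_formE; apply: Cderive_near.
have EA q : U q -> phi q A = psi q A by move=> /E ->.
exact: open_near Uo Up EA.
Qed.

Lemma partial_form_cst i u p : partial_form i (fun=> u) p = 0.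
Proof. by apply/ffunP => A; rewrite partial_formE Cderive_cst ffunE. Qed.

Lemma partial_formD U i phi psi p : smooth_form U phi -> smooth_form U psi -> U p ->
  partial_form i (fun q => phi q + psi q) p = partial_form i phi p + partial_form i psi p.
Proof.
move=> sphi spsi Up; apply/ffunP => A; rewrite covecDE !partial_formE.
under [X in Cderive _ X]eq_fun do rewrite covecDE.
exact: CderiveD (Csmooth_Cderivable i (sphi A) Up) (Csmooth_Cderivable i (spsi A) Up).
Qed.

(** Derivability at one point in one direction is what the product rule asks for, and
    [Cderivable_affine] transports it along the shift between charts. *)
Definition form_Cderivable phi p v := forall A, Cderivable (fun q => phi q A : C) p v.

Lemma smooth_form_Cderivable U phi i p : smooth_form U phi -> U p -> form_Cderivable phi p (e_ i).
Proof. by move=> sphi Up A; exact: Csmooth_Cderivable (sphi A) Up. Qed.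

Lemma partial_form_scale i (f : V -> C) phi p : Cderivable f p (e_ i) ->
  form_Cderivable phi p (e_ i) ->
  partial_form i (fun q => f q *: phi q) p =
  Cderive (e_ i) f p *: phi p + f p *: partial_form i phi p.
Proof.
move=> df dphi; apply/ffunP => A; rewrite covecDE !covecZE !partial_formE.
under [X in Cderive _ X]eq_fun do rewrite covecZE.
exact: CderiveM df (dphi A).
Qed.

Lemma partial_form_linear U i (c : C) phi psi p :
  open U -> smooth_form U phi -> smooth_form U psi ->
  U p -> partial_form i (fun q => c *: phi q + psi q) p =
    c *: partial_form i phi p + partial_form i psi p.
Proof.
move=> Uo sphi spsi Up; rewrite (partial_formD _ (smooth_formZ c Uo sphi) spsi Up).
rewrite (partial_form_scale (Cderivable_cst c p _) (smooth_form_Cderivable i sphi Up)).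
by rewrite Cderive_cst scale0r add0r.
Qed.

Lemma partial_form_wedge U i phi psi p : smooth_form U phi -> smooth_form U psi -> U p ->
  partial_form i (fun q => wedge (phi q) (psi q)) p =
  wedge (partial_form i phi p) (psi p) + wedge (phi p) (partial_form i psi p).
Proof.
move=> sphi spsi Up; apply/ffunP => A; rewrite covecDE !partial_formE.
under [X in Cderive _ X]eq_fun do rewrite wedgeE.
have dphi B := Csmooth_Cderivable i (sphi B) Up.
have dpsi B := Csmooth_Cderivable i (spsi B) Up.
have dc (c : C) B := CderivableM (Cderivable_cst c p (e_ i)) (dphi B).
have [_ ->] := @Cderive_sum R _ _ (index_enum _) (fun B : {set 'I_(n + n)} => B \subset A)
  (fun B q => (-1) ^+ inversions B (A :\: B)%SET * (phi q B : C) * (psi q (A :\: B)%SET : C))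
  p (e_ i) (fun B _ => CderivableM (dc _ B) (dpsi _)).
rewrite !wedgeE -big_split /=; apply: eq_bigr => B _.
by rewrite (CderiveM (dc _ B) (dpsi _)) (CderiveZ _ (dphi B)) !partial_formE.
Qed.

Lemma partial_form_sum U i (I : Type) (s : seq I) (P : pred I) (F : I -> dform R n) p :
  open U -> U p -> (forall j, P j -> smooth_form U (F j)) ->
  partial_form i (fun q => \sum_(j <- s | P j) F j q) p =
  \sum_(j <- s | P j) partial_form i (F j) p.
Proof.
move=> Uo Up sF; elim: s => [|j s IH].
  by under [X in partial_form _ X]eq_fun do rewrite big_nil; rewrite big_nil partial_form_cst.
under [X in partial_form _ X]eq_fun do rewrite big_cons; rewrite big_cons.
case: (boolP (P j)) => [Pj|_]; last exact: IH.
by rewrite (partial_formD i (sF j Pj) (smooth_form_sum s Uo sF) Up) IH.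
Qed.

Lemma partial_form_comm U i j phi p : open U -> smooth_form U phi -> U p ->
  partial_form i (partial_form j phi) p = partial_form j (partial_form i phi) p.
Proof.
move=> Uo sphi Up; apply/ffunP => A.
have DD k l : partial_form k (partial_form l phi) p A =
    Cderive (e_ k) (Cderive (e_ l) (fun q => phi q A : C)) p.
  rewrite partial_formE; apply: (f_equal (fun F => Cderive (e_ k) F p)).
  by apply/funext => q; exact: partial_formE.
apply: (etrans (DD i j)); apply: etrans (esym (DD j i)).
exact: (Cderive_comm i j Uo (sphi A) Up).
Qed.

Lemma partial_form_type_part i a b phi p :
  partial_form i (fun q => type_part a b (phi q)) p = type_part a b (partial_form i phi p).
Proof.
apply/ffunP => A; rewrite type_partE !partial_formE.
under [X in Cderive _ X]eq_fun do rewrite type_partE.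
by case: ((ltype A == a) && (rtype A == b)); [|exact: Cderive_cst].
Qed.

Lemma partial_form_of_type U i a b phi p : open U -> U p ->
  (forall q, U q -> of_type a b (phi q)) -> of_type a b (partial_form i phi p).
Proof.
move=> Uo Up tphi; rewrite /of_type -partial_form_type_part.
exact: (partial_form_eq i Uo Up tphi).
Qed.

Lemma partial_form_homogeneous i r phi p : (forall q, homogeneous r (phi q)) ->
  homogeneous r (partial_form i phi p).
Proof.
move=> hphi A Ar; rewrite partial_formE.
under [X in Cderive _ X]eq_fun do rewrite (hphi _ _ Ar).
exact: Cderive_cst.
Qed.

End FormCalculus.

(** * The Dolbeault operator in real coordinates *)

Section AntiholomorphicDifferential.
Variables (R : realType) (n : nat) (T : 'M[R[i]]_n).
Local Notation C := R[i].
Local Notation V := (pt R n).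
Local Notation e_ i := (delta_mx i 0 : 'cV[R]_(n + n)).
Implicit Types (U : set V) (phi psi : dform R n) (p q : V) (u : covec R n).

(** The differentials of the real coordinates x and y, indexed like the partial derivatives, so that
    [dext] becomes the single sum of [dextE]. *)
Definition dcoord (i : 'I_(n + n)) : covec R n :=
  match fintype.split i with inl j => dx T j | inr j => dy T j end.

Lemma dcoord_lshift j : dcoord (lshift n j) = dx T j.
Proof. by rewrite /dcoord (unsplitK (inl j)). Qed.

Lemma dcoord_rshift j : dcoord (rshift n j) = dy T j.
Proof. by rewrite /dcoord (unsplitK (inr j)). Qed.

Lemma dextE phi p : dext T phi p = \sum_i wedge (dcoord i) (partial_form i phi p).
Proof.
rewrite big_split_ord /= /dext big_split /=.
congr (_ + _); apply: eq_bigr => j _.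
  by rewrite dcoord_lshift.
by rewrite dcoord_rshift.
Qed.

Lemma homogeneous_dz (j : 'I_n) : homogeneous 1%N (dz R j).
Proof. by rewrite -(cards1 (lshift n j)); exact: homogeneous_blade. Qed.

Lemma homogeneous_dzbar (j : 'I_n) : homogeneous 1%N (dzbar R j).
Proof. by rewrite -(cards1 (rshift n j)); exact: homogeneous_blade. Qed.

Lemma homogeneous_dy j : homogeneous 1%N (dy T j).
Proof.
apply: homogeneous_sum => k _; apply: homogeneousZ; rewrite addrC -scaleN1r.
exact: homogeneous_linear (homogeneous_dzbar k) (homogeneous_dz k).
Qed.

Lemma homogeneous_dx j : homogeneous 1%N (dx T j).
Proof.
rewrite /dx addrC -scaleN1r; apply: homogeneous_linear (homogeneous_dz j).
by apply: homogeneous_sum => k _; exact: homogeneousZ (homogeneous_dy k).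
Qed.

Lemma homogeneous_dcoord i : homogeneous 1%N (dcoord i).
Proof.
by rewrite /dcoord; case: fintype.split => j; [exact: homogeneous_dx|exact: homogeneous_dy].
Qed.

Definition dcoord01 i : covec R n := type_part 0 1 (dcoord i).

Lemma homogeneous_dcoord01 i : homogeneous 1%N (dcoord01 i).
Proof. exact: of_type_homogeneous (of_type_part 0 1 _). Qed.

(* Agrees with the (0, r + 1)-part of the exterior derivative only on forms of type (0, r). *)
Definition delbar phi : dform R n := fun p => \sum_i wedge (dcoord01 i) (partial_form i phi p).

(** Partial derivatives in the real coordinates preserve the type (0, r), so by [wedge_type_partl]
    the projection to type (0, r + 1) falls on the constant factor [dcoord T i] alone. *)
Lemma dbarE U r phi p : open U -> U p -> (forall q, U q -> of_type 0 r (phi q)) ->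
  dbar T r phi p = delbar phi p.
Proof.
move=> Uo Up tphi; rewrite /dbar dextE type_part_sum; apply: eq_bigr => i _.
exact: esym (wedge_type_partl 0 1 _ (partial_form_of_type i Uo Up tphi)).
Qed.

Lemma delbar_of_type U r phi p : open U -> U p -> (forall q, U q -> of_type 0 r (phi q)) ->
  of_type 0 r.+1 (delbar phi p).
Proof. by move=> Uo Up tphi; rewrite -(dbarE Uo Up tphi); exact: of_type_part. Qed.

Lemma delbar_eq U phi psi p : open U -> U p -> (forall q, U q -> phi q = psi q) ->
  delbar phi p = delbar psi p.
Proof.
by move=> Uo Up E; apply: eq_bigr => i _; rewrite (partial_form_eq i Uo Up E).
Qed.

Lemma smooth_form_delbar U phi : open U -> smooth_form U phi -> smooth_form U (delbar phi).
Proof.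
move=> Uo sphi; apply: (smooth_form_sum _ Uo) => i _.
exact: smooth_form_wedge Uo (smooth_form_cst U _) (smooth_partial_form i sphi).
Qed.

Lemma delbar_cst u p : delbar (fun=> u) p = 0.
Proof. by rewrite /delbar big1 // => i _; rewrite partial_form_cst wedge0r. Qed.

Lemma delbar_linear U (c : C) phi psi p :
  open U -> smooth_form U phi -> smooth_form U psi -> U p ->
  delbar (fun q => c *: phi q + psi q) p = c *: delbar phi p + delbar psi p.
Proof.
move=> Uo sphi spsi Up; rewrite scaler_sumr -big_split /=; apply: eq_bigr => i _.
by rewrite (partial_form_linear i c Uo sphi spsi Up) wedge_linearr.
Qed.

Lemma delbarD U phi psi p :
  open U -> smooth_form U phi -> smooth_form U psi -> U p ->
  delbar (fun q => phi q + psi q) p = delbar phi p + delbar psi p.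
Proof.
move=> Uo sphi spsi Up; rewrite -big_split /=; apply: eq_bigr => i _.
by rewrite (partial_formD i sphi spsi Up) wedgeDr.
Qed.

(** The sum on the right is delbar of [f], kept in the form in which the transition functions enter
    [omega01_shift]. *)
Lemma delbar_scale (f : V -> C) phi p : (forall i, Cderivable f p (e_ i)) ->
  (forall i, form_Cderivable phi p (e_ i)) ->
  delbar (fun q => f q *: phi q) p =
  wedge (\sum_i Cderive (e_ i) f p *: dcoord01 i) (phi p) + f p *: delbar phi p.
Proof.
move=> df dphi; rewrite scaler_sumr wedge_suml -big_split /=; apply: eq_bigr => i _.
by rewrite (partial_form_scale (df i) (dphi i)) wedgeDr !wedgeZr wedgeZl.
Qed.

(** The sign arises from moving [dcoord01 T i] past [phi p]. *)
Lemma delbar_wedge U r phi psi p : smooth_form U phi -> smooth_form U psi -> U p ->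
  homogeneous r (phi p) ->
  delbar (fun q => wedge (phi q) (psi q)) p =
  wedge (delbar phi p) (psi p) + (-1) ^+ r *: wedge (phi p) (delbar psi p).
Proof.
move=> sphi spsi Up hphi.
rewrite wedge_suml wedge_sumr scaler_sumr -big_split /=; apply: eq_bigr => i _.
rewrite (partial_form_wedge i sphi spsi Up) wedgeDr !wedgeA; congr (_ + _).
by rewrite (wedgeC (@homogeneous_dcoord01 i) hphi) mul1n wedgeZl.
Qed.

Lemma dcoord01_anticomm i j :
  wedge (dcoord01 i) (dcoord01 j) = - wedge (dcoord01 j) (dcoord01 i).
Proof.
by rewrite (wedgeC (@homogeneous_dcoord01 i) (@homogeneous_dcoord01 j)) expr1 scaleN1r.
Qed.

Lemma eq_oppr0 u : u = - u -> u = 0.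
Proof.
move=> uN; have : (2 : C) *: u = 0 by rewrite scaler_nat mulr2n {1}uN addNr.
move=> /(congr1 (fun v => (2 : C)^-1 *: v)).
by rewrite scalerA mulVf ?pnatr_eq0 // scale1r scaler0.
Qed.

(** The [dcoord01 T i] are constant, so only second derivatives of [phi] appear. These commute while
    the [dcoord01 T i] anticommute, and exchanging the indices shows the double sum to be its own
    negative. *)
Lemma delbar_delbar U phi p : open U -> smooth_form U phi -> U p -> delbar (delbar phi) p = 0.
Proof.
move=> Uo sphi Up.
pose t i j := wedge (wedge (dcoord01 i) (dcoord01 j)) (partial_form i (partial_form j phi) p).
have E : delbar (delbar phi) p = \sum_i \sum_j t i j.
  apply: eq_bigr => i _.
  pose F j : dform R n := fun q => wedge (dcoord01 j) (partial_form j phi q).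
  have sdphi j : smooth_form U (partial_form j phi) := smooth_partial_form j sphi.
  have sF j : smooth_form U (F j).
    exact: smooth_form_wedge Uo (smooth_form_cst U _) (sdphi j).
  have -> : partial_form i (delbar phi) p = \sum_j partial_form i (F j) p.
    exact: (@partial_form_sum R n U i _ (index_enum _) predT F p Uo Up (fun j _ => sF j)).
  rewrite wedge_sumr; apply: eq_bigr => j _; rewrite /t -wedgeA; congr (wedge _ _).
  rewrite (partial_form_wedge i (smooth_form_cst U _) (sdphi j) Up).
  by rewrite partial_form_cst wedge0l add0r.
apply: eq_oppr0; rewrite {1}E exchange_big E /= -sumrN; apply: eq_bigr => i _.
rewrite -sumrN; apply: eq_bigr => j _.
by rewrite /t dcoord01_anticomm wedgeNl (partial_form_comm _ _ Uo sphi Up).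
Qed.

End AntiholomorphicDifferential.

(** * Coordinates and charts of the torus *)

Section LinearCoordinates.
Variables (R : realType) (m : nat).
Local Notation e_ i := (delta_mx i 0 : 'cV[R]_m).

Lemma coord_line (k : 'I_m) (v p : 'cV[R]_m) (h : R) :
  (h *: v + p) k 0 = h *: (v k 0 : R^o) + p k 0.
Proof. by rewrite !mxE. Qed.

Lemma smooth_coord (U : set 'cV[R]_m) k : smooth U (fun x => x k 0).
Proof.
case=> [|l] /=; first by move=> p _; exact: coord_continuous.
move=> i; split=> [p _|].
  apply: (@derivable_affine R 'cV[R]_m R id _ (fun x => x k 0) p _ (coord_line k _ _)).
  exact: derivable_id.
suff -> : (fun p => 'D_(e_ i) (fun x : 'cV[R]_m => x k 0) p) = (fun=> (e_ i) k 0) by exact: Ck_cst.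
apply/funext => p.
apply: etrans (@derive_affine R 'cV[R]_m R id _ (fun x => x k 0) p _ (coord_line k _ _)) _.
exact: derive_id.
Qed.

End LinearCoordinates.

Section TorusCoordinates.
Variables (R : realType) (n : nat).
Local Notation C := R[i].
Local Notation toC := (map_mx (real_complex R)).
Local Notation toR := (map_mx (intr : int -> R)).
Local Notation e_ i := (delta_mx i 0 : 'cV[R]_(n + n)).
Implicit Types (p q : pt R n) (U : set (pt R n)).

Lemma xcoordE p j : xcoord p j 0 = p (lshift n j) 0.
Proof. by rewrite mxE. Qed.

Lemma ycoordE p j : ycoord p j 0 = p (rshift n j) 0.
Proof. by rewrite mxE. Qed.

Lemma xcoord_line (h : R) (v p : 'cV[R]_(n + n)) :
  xcoord (h *: v + p) = h *: xcoord v + xcoord p.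
Proof. by apply/matrixP => j k; rewrite !mxE. Qed.

Lemma xcoord_lshift j : xcoord (e_ (lshift n j)) = delta_mx j 0.
Proof. by apply/matrixP => i k; rewrite !mxE (inj_eq (@lshift_inj n n)). Qed.

Lemma xcoord_rshift j : xcoord (e_ (rshift n j)) = 0.
Proof. by apply/matrixP => i k; rewrite !mxE eq_lrshift. Qed.

Lemma xcoord_continuous p : {for p, continuous (@xcoord R n)}.
Proof.
move=> A [P Pp PA].
(* Neighbourhoods of a matrix are given entrywise: the x-entries are constrained by [P], the
   y-entries are free. *)
exists (fun i j => if fintype.split i is inl i' then P i' j else setT) => [i j|q Pq].
  case: fintype.splitP => [i' ii'|_ _]; last exact: filterT.
  have -> : i = lshift n i' by exact/val_inj.
  by have := Pp i' j; rewrite mxE.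
by apply: PA => i j; have := Pq (lshift n i) j; rewrite (unsplitK (inl i)) mxE.
Qed.

(** Derivatives along x are again functions of this kind and those along y vanish, so the induction
    closes. *)
Lemma smooth_xcoord (f : 'cV[R]_n -> R) : smooth [set: 'cV[R]_n] f ->
  smooth [set: pt R n] (fun p => f (xcoord p)).
Proof.
move=> + k; elim: k f => [|k IH] f sf /=.
  move=> p _; apply: continuous_comp; first exact: xcoord_continuous.
  exact: smooth_continuous sf _.
move=> i; have [j ->|j ->] := split_ordP i.
- have D p : 'D_(e_ (lshift n j)) (fun q : 'cV[R]_(n + n) => f (xcoord q)) p =
      'D_(delta_mx j 0) f (xcoord p).
    by rewrite (derive_affine f (fun h => xcoord_line h _ p)) xcoord_lshift.
  split=> [p _|].
    apply: (derivable_affine (fun h => xcoord_line h _ p)); rewrite xcoord_lshift.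
    exact: smooth_derivable sf _.
  by rewrite (funext D); exact: (IH ('D_(delta_mx j 0) f) (smooth_derive j sf)).
- have D p : 'D_(e_ (rshift n j)) (fun q : 'cV[R]_(n + n) => f (xcoord q)) p = 0.
    by rewrite (derive_affine f (fun h => xcoord_line h _ p)) xcoord_rshift derive0.
  split=> [p _|].
    apply: (derivable_affine (fun h => xcoord_line h _ p)); rewrite xcoord_rshift.
    exact: derivable0.
  by rewrite (funext D); exact: Ck_cst.
Qed.

Lemma open_arc_open (eps : R) l : open (open_arc eps l).
Proof.
rewrite (_ : open_arc eps l = `]l%:R / 3%:R - eps, l.+1%:R / 3%:R + eps[%classic).
  exact: interval_open.
by rewrite set_itvoo.
Qed.

Lemma open_box eps (b : chart n) : open (box eps b : set (pt R n)).
Proof.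
rewrite openE => p [px py].
exists (fun i _ => match fintype.split i with
    inl j => open_arc eps (b.1 j) | inr k => open_arc eps (b.2 k) end) => [i j|q Pq].
  rewrite ord1; case: fintype.splitP => [i' ii'|i' ii'].
    have -> : i = lshift n i' by exact/val_inj.
    by apply: open_nbhs_nbhs; split; [exact: open_arc_open|rewrite -xcoordE].
  have -> : i = rshift n i' by exact/val_inj.
  by apply: open_nbhs_nbhs; split; [exact: open_arc_open|rewrite -ycoordE].
split=> j.
  by have := Pq (lshift n j) 0; rewrite (unsplitK (inl j)) -xcoordE.
by have := Pq (rshift n j) 0; rewrite (unsplitK (inr j)) -ycoordE.
Qed.

Lemma shift2_line v w (h : R) (u p : 'cV[R]_(n + n)) :
  shift2 v w (h *: u + p) = h *: u + shift2 v w p.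
Proof. by rewrite /shift2 addrA. Qed.

Lemma open_overlap eps (b c : chart n) v w : open (overlap eps b c v w : set (pt R n)).
Proof.
apply: openI; first exact: open_box.
apply: (@open_comp 'cV[R]_(n + n) 'cV[R]_(n + n) (shift2 v w) (box eps c)); last exact: open_box.
move=> p _.
by apply: (@continuousD _ _ _ id (fun=> col_mx (toR v) (toR w)));
  [exact: cvg_id|exact: cst_continuous].
Qed.

(** The phase is a linear function of y, so [derivable_affine] reduces the claim to the derivability
    of cos and sin. *)
Lemma Cderivable_trans (E : bundle_data R n) b c v w p u : Cderivable (trans E b c v w) p u.
Proof.
pose L (q : 'cV[R]_(n + n)) : R := - (2 * pi * ((toR (a_mx E *m v))^T *m ycoord q) 0 0).
have LE (h : R) : L (h *: u + p) = h *: L u + L p.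
  have aux (M N : 'M[R]_1) : (h *: M + N) 0 0 = h * M 0 0 + N 0 0 by rewrite !mxE.
  by rewrite /L /ycoord linearP mulmxDr -scalemxAr aux /GRing.scale /=; ring.
split.
  by apply: (derivable_affine (f := cos) LE); exact/diff_derivable/derivable1_diffP.
by apply: (derivable_affine (f := sin) LE); exact/diff_derivable/derivable1_diffP.
Qed.

Lemma partial_form_shift i (phi : dform R n) v w p :
  partial_form i (fun q => phi (shift2 v w q)) p = partial_form i phi (shift2 v w p).
Proof.
apply/ffunP => A; rewrite !partial_formE.
exact: (Cderive_affine (L0 := id) (fun h => shift2_line v w h _ p) (fun q => phi q A)).
Qed.

End TorusCoordinates.

(** * Connection forms and morphisms *)

Section ConnectionForms.
Variables (R : realType) (n : nat) (T : 'M[R[i]]_n) (tau : 'M[R]_n) (eps : R).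
Local Notation C := R[i].
Local Notation toC := (map_mx (real_complex R)).
Local Notation e_ i := (delta_mx i 0 : 'cV[R]_(n + n)).
Implicit Types (E : bundle_data R n) (b c : chart n) (p q : pt R n).

Lemma Csmooth_real (U : set (pt R n)) (f : pt R n -> R) : smooth U f ->
  Csmooth U (fun p => (f p)%:C).
Proof. by move=> sf; split; [exact: sf|exact: smooth_cst]. Qed.

Lemma smooth_form1 (U : set (pt R n)) (f : pt R n -> 'rV[C]_n) eta : open U ->
  (forall j, Csmooth U (fun p => f p 0 j)) -> smooth_form U (fun p => form1 (f p) eta).
Proof.
move=> Uo sf; apply: (smooth_form_sum _ Uo) => j _.
exact: (smooth_form_scale Uo (sf j) (smooth_form_cst U (eta j))).
Qed.

Lemma homogeneous_form1 (f : 'rV[C]_n) (eta : 'I_n -> covec R n) :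
  (forall j, homogeneous 1%N (eta j)) -> homogeneous 1%N (form1 f eta).
Proof. by move=> heta; apply: homogeneous_sum => j _; exact: homogeneousZ (heta j). Qed.

Lemma smooth_omega E b : smooth_form [set: pt R n] (omega T tau E b).
Proof.
apply: (smooth_formB openT); apply: (smooth_formZ _ openT); apply: (smooth_form1 _ openT) => j.
  under eq_fun do rewrite mxE [X in X + _]mxE [X in X + _]mxE.
  apply: (CsmoothD openT _ (Csmooth_cst _ _)); apply: Csmooth_real.
  exact: (smooth_xcoord (s_fun_smooth E j)).
have xE (p : pt R n) : toC ((xcoord p)^T *m tau) 0 j =
    \sum_k ((xcoord p) k 0)%:C * (tau k j)%:C.
  rewrite !mxE rmorph_sum; apply: eq_bigr => k _.
  by rewrite rmorphM mxE.
under eq_fun do rewrite xE.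
apply: (Csmooth_sum _ openT) => k _; apply: (CsmoothM openT _ (Csmooth_cst _ _)).
apply: Csmooth_real; exact: (smooth_xcoord (smooth_coord setT k)).
Qed.

Lemma homogeneous_omega E b p : homogeneous 1%N (omega T tau E b p).
Proof.
rewrite /omega addrC -scaleNr; apply: homogeneous_linear.
  exact: homogeneous_form1 (homogeneous_dx T).
exact: homogeneousZ (homogeneous_form1 _ (homogeneous_dy T)).
Qed.

Definition omega01 E b : dform R n := fun p => type_part 0 1 (omega T tau E b p).

Lemma smooth_omega01 E b U : smooth_form U (omega01 E b).
Proof.
exact: (smooth_form_type_part 0 1 (smooth_form_subset (@subsetT _ U) (smooth_omega E b))).
Qed.

(** The derivatives of [omega] are 1-forms, so by [type_part02_wedge] only its (0, 1)-part
    contributes to type (0, 2). *)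
Lemma type_part02_dext_omega E b p :
  type_part 0 2 (dext T (omega T tau E b) p) = delbar T (omega01 E b) p.
Proof.
rewrite dextE type_part_sum; apply: eq_bigr => i _.
rewrite (type_part02_wedge (homogeneous_dcoord T i)
  (partial_form_homogeneous i p (homogeneous_omega E b))).
by rewrite -partial_form_type_part.
Qed.

(** This is integrability read as an equation for the connection form. The right-hand side is the
    same for all objects, so it cancels in differences. *)
Lemma delbar_omega01 (E : object T tau eps) b p : box eps b p ->
  delbar T (omega01 E b) p = type_part 0 2 (conn1 (flat_gerbe T tau) b p).
Proof.
have [_ curv0] := obj_integrable E => /curv0/eqP.
by rewrite /curvature /= type_partD type_partN subr_eq0 type_part02_dext_omega => /eqP.
Qed.

Lemma type_part01_dext_scalar (f : pt R n -> C) p :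
  type_part 0 1 (dext T (scalar_form f) p) = \sum_i Cderive (e_ i) f p *: dcoord01 T i.
Proof.
rewrite dextE type_part_sum; apply: eq_bigr => i _.
by rewrite partial_scalar wedge_blade0 type_partZ.
Qed.

(** The (0, 1)-part of the twisted connection condition. The 0-connection term does not depend on
    the object; the last term is the logarithmic derivative of its transition function. *)
Lemma omega01_shift (E : object T tau eps) b c v w p : overlap eps b c v w p ->
  omega01 E c (shift2 v w p) = type_part 0 1 (conn0 (flat_gerbe T tau) b c v p) +
    (omega01 E b p + (trans E b c v w p)^-1 *:
      \sum_i Cderive (e_ i) (trans E b c v w) p *: dcoord01 T i).
Proof.
have [tw _] := obj_integrable E => /tw/(congr1 (type_part 0 1)).
rewrite type_partD type_partN type_partD type_partZ type_part01_dext_scalar => <-.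
by rewrite subrK.
Qed.

End ConnectionForms.

(* If u and v represent one section in two frames related by tY and tX, with
   logarithmic derivatives gY / tY and gX / tX, then the covariant derivatives
   du + a' /\ u and dv + a /\ v are related in the same way. *)
Lemma wedge_gauge (F : fieldType) k (tX tY : F) (u v a gX gY du dv : ext F k) :
  tX != 0 -> tY != 0 -> tY *: u = tX *: v ->
  wedge gY u + tY *: du = wedge gX v + tX *: dv ->
  tY *: (du + wedge (a + (tY^-1 *: gY - tX^-1 *: gX)) u) = tX *: (dv + wedge a v).
Proof.
move=> tX0 tY0 uv duv.
have E1 : tY *: wedge a u = tX *: wedge a v by rewrite -wedgeZr uv wedgeZr.
have E2 : tY *: wedge (tY^-1 *: gY) u = wedge gY u.
  by rewrite wedgeZl scalerA mulfV // scale1r.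
have E3 : tY *: wedge (tX^-1 *: gX) u = wedge gX v.
  by rewrite -wedgeZr uv wedgeZl wedgeZr scalerA mulVf // scale1r.
have E4 : tY *: du = wedge gX v + tX *: dv - wedge gY u.
  by rewrite -duv addrAC subrr add0r.
rewrite !wedgeDl wedgeNl !scalerDr scalerN E1 E2 E3 E4.
by rewrite addrCA [_ - wedge gY u + _]addrA subrK addrAC subrr add0r addrC.
Qed.

(** The algebra of the Leibniz rule, with [a] and [b] the connection differences of the two factors
    and [du], [dv] the values of [delbar]: the 1-form [b] passes [u] with sign $(-1)^r$. *)
Lemma wedge_leibniz (F : comNzRingType) k r (a b u v du dv : ext F k) :
  homogeneous 1%N b -> homogeneous r u ->
  wedge du v + (-1) ^+ r *: wedge u dv + wedge (a + b) (wedge u v) =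
  wedge (du + wedge a u) v + (-1) ^+ r *: wedge u (dv + wedge b v).
Proof.
move=> hb hu.
have E : wedge b (wedge u v) = (-1) ^+ r *: wedge u (wedge b v).
  by rewrite wedgeA (wedgeC hb hu) mul1n wedgeZl -wedgeA.
by rewrite !wedgeDl wedgeDr scalerDr E wedgeA addrACA.
Qed.

(** * Differential and composition of morphisms *)

Section DGCategory.
Variables (R : realType) (n : nat) (T : 'M[R[i]]_n) (tau : 'M[R]_n) (eps : R).
Local Notation C := R[i].
Local Notation e_ i := (delta_mx i 0 : 'cV[R]_(n + n)).
Local Notation obj := (object T tau eps).
Local Notation delbar := (delbar T).
Implicit Types (X Y Z : obj) (b c : chart n) (p q : pt R n) (phi psi : form_family R n).

(** The (0, 1)-part of the connection form of the Hom bundle from [X] to [Y], an ordinary line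
    bundle because the gerbe terms of [X] and [Y] cancel. *)
Definition omega01_diff (X Y : obj) b : dform R n :=
  fun p => omega01 T tau Y b p - omega01 T tau X b p.

Lemma smooth_omega01_diff X Y b U : open U -> smooth_form U (omega01_diff X Y b).
Proof.
by move=> Uo; exact: (smooth_formB Uo (smooth_omega01 T tau Y b U) (smooth_omega01 T tau X b U)).
Qed.

Lemma of_type_omega01_diff X Y b p : of_type 0 1 (omega01_diff X Y b p).
Proof.
rewrite /omega01_diff addrC -scaleN1r.
exact: (of_type_linear _ (of_type_part 0 1 _) (of_type_part 0 1 _)).
Qed.

Lemma homogeneous_omega01_diff X Y b p : homogeneous 1%N (omega01_diff X Y b p).
Proof. exact: (of_type_homogeneous (of_type_omega01_diff X Y b p)). Qed.

(** The curvature of the Hom bundle has no (0, 2)-part: by [delbar_omega01] both connection forms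
    have the (0, 2)-part of the 1-connection as their delbar. *)
Lemma delbar_omega01_diff X Y b p : box eps b p -> delbar (omega01_diff X Y b) p = 0.
Proof.
move=> bp; have -> : delbar (omega01_diff X Y b) p =
    delbar (fun q => (-1) *: omega01 T tau X b q + omega01 T tau Y b q) p.
  apply: (delbar_eq T (U := setT) openT I) => q _.
  by rewrite /omega01_diff addrC scaleN1r.
rewrite (delbar_linear T (-1) openT (smooth_omega01 T tau X b _) (smooth_omega01 T tau Y b _) I).
have NK (u : covec R n) : (-1 : C) *: u + u = 0 by rewrite scaleN1r addNr.
exact: (etrans (f_equal2 (fun u v : covec R n => (-1 : C) *: u + v)
  (delbar_omega01 X bp) (delbar_omega01 Y bp)) (NK _)).
Qed.

Lemma hom_diff_out X Y r phi b p : ~ box eps b p -> hom_diff X Y r phi b p = 0.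
Proof. by move=> nbp; rewrite /hom_diff patchN // notin_setE. Qed.

(** Graded commutativity turns the right multiplication by the connection form of [X] into a left
    one, absorbing the sign $(-1)^r$; the two connection terms then merge. *)
Lemma hom_diffE X Y r phi b p : hom_forms X Y r phi -> box eps b p ->
  hom_diff X Y r phi b p = delbar (phi b) p + wedge (omega01_diff X Y b p) (phi b p).
Proof.
move=> [_ _ tphi _] bp; rewrite /hom_diff patchT ?inE //.
rewrite (dbarE T (@open_box R n eps b) bp (tphi b)) -addrA; congr (_ + _).
have hphi := of_type_homogeneous (tphi b p bp).
have h1 : homogeneous 1%N (omega01 T tau X b p) := of_type_homogeneous (of_type_part 0 1 _).
rewrite (wedgeC hphi h1) add0n muln1 scalerA -expr2 sqrr_sign scale1r.
by rewrite -wedgeNl -wedgeDl.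
Qed.

(** The gluing relation holds on the whole open overlap, so delbar may be applied to it. The result
    and the relation itself are the two hypotheses of [wedge_gauge]. *)
Lemma hom_diff_compat X Y r phi b c v w p : hom_forms X Y r phi -> overlap eps b c v w p ->
  trans Y b c v w p *: hom_diff X Y r phi c (shift2 v w p)
  = trans X b c v w p *: hom_diff X Y r phi b p.
Proof.
move=> hphi Op; have [bp cp] := Op; have [_ sphi _ cphi] := hphi.
rewrite (hom_diffE hphi bp) (hom_diffE hphi cp).
set tX := trans X b c v w; set tY := trans Y b c v w.
(* The local form of chart [c] read in the coordinates of [b]; a translation commutes with the
   partial derivatives. *)
pose psi : dform R n := fun q => phi c (shift2 v w q).
have delpsi : delbar psi p = delbar (phi c) (shift2 v w p).
  by apply: eq_bigr => i _; rewrite partial_form_shift.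
have dpsi i : form_Cderivable psi p (e_ i).
  move=> A; apply: (Cderivable_affine (L0 := id) (fun h => shift2_line v w h (e_ i) p)
    (f := fun q => phi c q A)).
  exact: (smooth_form_Cderivable i (sphi c) cp).
have dphi i := smooth_form_Cderivable i (sphi b) bp.
have dX i : Cderivable tX p (e_ i) by exact: Cderivable_trans.
have dY i : Cderivable tY p (e_ i) by exact: Cderivable_trans.
have := delbar_eq T (@open_overlap R n eps b c v w) Op (cphi b c v w).
rewrite (delbar_scale T dY dpsi) (delbar_scale T dX dphi) delpsi.
have := cphi b c v w p Op.
rewrite {1 2}/omega01_diff (omega01_shift X Op) (omega01_shift Y Op) -/tX -/tY.
have tX0 : tX p != 0 := cis_neq0 _.
have tY0 : tY p != 0 := cis_neq0 _.
move: (\sum_i Cderive (e_ i) tY p *: _) (\sum_i Cderive (e_ i) tX p *: _) => gY gX.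
move: (delbar _ _) (delbar _ _) (type_part 0 1 _) => db dc k.
rewrite -/(psi p); move: (psi p) (phi b p) (omega01 _ _ _ _ _) (omega01 _ _ _ _ _).
move=> u u' oX oY uu' ddE.
(* The 0-connection contributes the same [k] to both objects and drops out. *)
have -> : k + (oY + (tY p)^-1 *: gY) - (k + (oX + (tX p)^-1 *: gX)) =
    (oY - oX) + ((tY p)^-1 *: gY - (tX p)^-1 *: gX).
  by rewrite opprD addrACA subrr add0r opprD addrACA.
exact: wedge_gauge.
Qed.

Lemma hom_diff_hom X Y r phi : hom_forms X Y r phi -> hom_forms X Y r.+1 (hom_diff X Y r phi).
Proof.
move=> hphi; have [phi0 sphi tphi cphi] := hphi; split.
- by move=> b p; exact: hom_diff_out.
- move=> b; have Uo := @open_box R n eps b.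
  have E p : box eps b p -> delbar (phi b) p + wedge (omega01_diff X Y b p) (phi b p) =
      hom_diff X Y r phi b p by move=> bp; rewrite (hom_diffE hphi bp).
  apply: (smooth_form_eq Uo E); apply: (smooth_formD Uo).
    exact: (smooth_form_delbar T Uo (sphi b)).
  exact: (smooth_form_wedge Uo (smooth_omega01_diff X Y b Uo) (sphi b)).
- move=> b p bp; rewrite (hom_diffE hphi bp) -[delbar _ _]scale1r.
  apply: of_type_linear; first exact: (delbar_of_type T (@open_box R n eps b) bp (tphi b)).
  exact: (of_type_wedge (of_type_omega01_diff X Y b p) (tphi b p bp)).
- by move=> b c v w p; exact: hom_diff_compat.
Qed.

(** With $\alpha$ the connection difference, the square consists of $\bar\partial^2\phi$,
    $\bar\partial\alpha\wedge\phi$, two opposite terms $\alpha\wedge\bar\partial\phi$ and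
    $\alpha\wedge\alpha\wedge\phi$. The last vanishes because $\alpha$ has odd degree. *)
Lemma hom_diff_diff X Y r phi : hom_forms X Y r phi ->
  hom_diff X Y r.+1 (hom_diff X Y r phi) = 0.
Proof.
move=> hphi; have [_ sphi tphi _] := hphi; apply/funext => b; apply/funext => p.
case: (pselect (box eps b p)) => [bp|nbp]; last exact: hom_diff_out.
have Uo := @open_box R n eps b.
have sal := smooth_omega01_diff X Y b Uo; have hal := homogeneous_omega01_diff X Y b p.
rewrite (hom_diffE (hom_diff_hom hphi) bp) (hom_diffE hphi bp).
have E q : box eps b q -> hom_diff X Y r phi b q =
    delbar (phi b) q + wedge (omega01_diff X Y b q) (phi b q) := hom_diffE hphi.
rewrite (delbar_eq T Uo bp E).
rewrite (delbarD T Uo (smooth_form_delbar T Uo (sphi b)) (smooth_form_wedge Uo sal (sphi b)) bp).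
rewrite (delbar_delbar T Uo (sphi b) bp) add0r (delbar_wedge T sal (sphi b) bp hal).
rewrite (delbar_omega01_diff X Y bp) wedge0l add0r expr1 scaleN1r wedgeDr wedgeA addKr.
have -> : wedge (omega01_diff X Y b p) (omega01_diff X Y b p) = 0.
  by apply: eq_oppr0; rewrite {1}(wedgeC hal hal) expr1 scaleN1r.
exact: wedge0l.
Qed.

Lemma hom_comp_hom X Y Z r2 r1 phi psi : hom_forms Y Z r2 phi -> hom_forms X Y r1 psi ->
  hom_forms X Z (r1 + r2)%N (hom_comp X Y Z phi psi).
Proof.
move=> [phi0 sphi tphi cphi] [psi0 spsi tpsi cpsi]; split.
- by move=> b p nbp; rewrite /hom_comp phi0 // wedge0l.
- by move=> b; exact: (smooth_form_wedge (@open_box R n eps b) (sphi b) (spsi b)).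
- move=> b p bp; rewrite addnC; exact: (of_type_wedge (tphi b p bp) (tpsi b p bp)).
(* The transition function of the middle bundle [Y] leaves the first factor and enters the
   second. *)
- move=> b c v w p Op; rewrite /hom_comp -wedgeZl cphi // wedgeZl -wedgeZr cpsi //.
  by rewrite wedgeZr.
Qed.

Lemma hom_leibniz X Y Z r2 r1 phi psi : hom_forms Y Z r2 phi -> hom_forms X Y r1 psi ->
  hom_diff X Z (r1 + r2)%N (hom_comp X Y Z phi psi)
  = hom_comp X Y Z (hom_diff Y Z r2 phi) psi
    + (-1 : C) ^+ r2 *: hom_comp X Y Z phi (hom_diff X Y r1 psi).
Proof.
move=> hphi hpsi; apply/funext => b; apply/funext => p.
have [phi0 sphi tphi _] := hphi; have [psi0 spsi _ _] := hpsi.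
case: (pselect (box eps b p)) => [bp|nbp]; last first.
  (* Outside the chart both sides are 0 by the extension convention. *)
  rewrite hom_diff_out // [RHS]/=.
  have -> : (hom_comp X Y Z (hom_diff Y Z r2 phi) psi
    + (-1 : C) ^+ r2 *: hom_comp X Y Z phi (hom_diff X Y r1 psi)) b p =
    wedge (hom_diff Y Z r2 phi b p) (psi b p) +
    (-1 : C) ^+ r2 *: wedge (phi b p) (hom_diff X Y r1 psi b p) by [].
  by rewrite hom_diff_out // phi0 // !wedge0l scaler0 addr0.
have -> : (hom_comp X Y Z (hom_diff Y Z r2 phi) psi
    + (-1 : C) ^+ r2 *: hom_comp X Y Z phi (hom_diff X Y r1 psi)) b p =
    wedge (hom_diff Y Z r2 phi b p) (psi b p) +
    (-1 : C) ^+ r2 *: wedge (phi b p) (hom_diff X Y r1 psi b p) by [].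
rewrite (hom_diffE (hom_comp_hom hphi hpsi) bp) (hom_diffE hphi bp) (hom_diffE hpsi bp).
have hp := of_type_homogeneous (tphi b p bp).
have -> : hom_comp X Y Z phi psi b = fun q => wedge (phi b q) (psi b q) by [].
rewrite (delbar_wedge T (sphi b) (spsi b) bp hp).
(* The connection form of the middle object [Y] telescopes. *)
have -> : omega01_diff X Z b p = omega01_diff Y Z b p + omega01_diff X Y b p.
  by rewrite /omega01_diff addrA subrK.
exact: (wedge_leibniz _ _ _ _ (homogeneous_omega01_diff X Y b p) hp).
Qed.

End DGCategory.

(** * Linearity and units *)

Section DGAxioms.
Variables (R : realType) (n : nat) (T : 'M[R[i]]_n) (tau : 'M[R]_n) (eps : R).
Local Notation C := R[i].
Local Notation obj := (object T tau eps).
Implicit Types (X Y Z : obj) (b : chart n) (p : pt R n) (phi psi : form_family R n).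

Lemma hom_forms0 X Y r : hom_forms X Y r 0.
Proof.
split=> [b p _ //|b|b p _|b c v w p _].
- exact: smooth_form_cst.
- exact: of_type0.
- by rewrite !scaler0.
Qed.

Lemma hom_forms_linear X Y r (c : C) phi psi :
  hom_forms X Y r phi -> hom_forms X Y r psi -> hom_forms X Y r (c *: phi + psi).
Proof.
move=> [phi0 sphi tphi cphi] [psi0 spsi tpsi cpsi].
have E b p : (c *: phi + psi) b p = c *: phi b p + psi b p by [].
split=> [b p nbp|b|b p bp|b b' v w p Op].
- by rewrite E phi0 // psi0 // scaler0 addr0.
- exact: (smooth_form_linear c (@open_box R n eps b) (sphi b) (spsi b)).
- exact: (of_type_linear c (tphi b p bp) (tpsi b p bp)).
- have S (t : C) (f g : covec R n) : t *: (c *: f + g) = c *: (t *: f) + t *: g.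
    by rewrite scalerDr !scalerA mulrC.
  by rewrite !E !S (cphi _ _ _ _ _ Op) (cpsi _ _ _ _ _ Op).
Qed.

Lemma hom_diff_linear X Y r (c : C) phi psi : hom_forms X Y r phi -> hom_forms X Y r psi ->
  hom_diff X Y r (c *: phi + psi) = c *: hom_diff X Y r phi + hom_diff X Y r psi.
Proof.
move=> hphi hpsi; apply/funext => b; apply/funext => p.
have E (f g : form_family R n) : (c *: f + g) b p = c *: f b p + g b p by [].
rewrite E; case: (pselect (box eps b p)) => [bp|nbp]; last first.
  by rewrite !hom_diff_out // scaler0 addr0.
rewrite (hom_diffE (hom_forms_linear c hphi hpsi) bp) (hom_diffE hphi bp) (hom_diffE hpsi bp).
have [_ sphi _ _] := hphi; have [_ spsi _ _] := hpsi.
have -> : delbar T ((c *: phi + psi) b) p = c *: delbar T (phi b) p + delbar T (psi b) p.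
  exact: (delbar_linear T c (@open_box R n eps b) (sphi b) (spsi b) bp).
by rewrite E wedge_linearr scalerDr addrACA.
Qed.

(** The identity morphism: the blade of the empty set is the constant function 1, cut off outside
    each chart to match the extension by 0 required in [hom_forms]. *)
Definition unit_form : form_family R n :=
  fun b => patch (fun=> 0) (box eps b) (fun=> blade C finset.set0).

Lemma unit_formE b p : box eps b p -> unit_form b p = blade C finset.set0.
Proof. by move=> bp; rewrite /unit_form patchT // inE. Qed.

Lemma unit_form_out b p : ~ box eps b p -> unit_form b p = 0.
Proof. by move=> nbp; rewrite /unit_form patchN // notin_setE. Qed.

Lemma hom_unit_form X : hom_forms X X 0%N unit_form.
Proof.
split=> [b p|b|b p bp|b c v w p [bp cp]].
- exact: unit_form_out.
- have E p : box eps b p -> blade C finset.set0 = unit_form b p by move/unit_formE.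
  exact: (smooth_form_eq (@open_box R n eps b) E (smooth_form_cst _ _)).
- rewrite (unit_formE bp); apply/of_typeP => A; rewrite ffunE; case: (A =P finset.set0) => [->|//].
  by rewrite /ltype /rtype !eq_card0 // => i; rewrite !inE.
- by rewrite (unit_formE bp) (unit_formE cp).
Qed.

Lemma hom_diff_unit_form X : hom_diff X X 0%N unit_form = 0.
Proof.
apply/funext => b; apply/funext => p.
case: (pselect (box eps b p)) => [bp|nbp]; last exact: hom_diff_out.
rewrite (hom_diffE (hom_unit_form X) bp) /omega01_diff subrr wedge0l addr0.
rewrite (delbar_eq T (@open_box R n eps b) bp (@unit_formE b)).
exact: delbar_cst.
Qed.

Lemma hom_comp_unitr X Y r phi : hom_forms X Y r phi -> hom_comp X X Y phi unit_form = phi.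
Proof.
move=> [phi0 _ _ _]; apply/funext => b; apply/funext => p; rewrite /hom_comp.
case: (pselect (box eps b p)) => [bp|nbp]; first by rewrite (unit_formE bp) wedge1r.
by rewrite phi0 // wedge0l.
Qed.

Lemma hom_comp_unitl X Y r phi : hom_forms Y X r phi -> hom_comp Y X X unit_form phi = phi.
Proof.
move=> [phi0 _ _ _]; apply/funext => b; apply/funext => p; rewrite /hom_comp.
case: (pselect (box eps b p)) => [bp|nbp]; first by rewrite (unit_formE bp) wedge1l.
by rewrite phi0 // wedge0r.
Qed.

End DGAxioms.

Theorem theorem5p7 (R : realType) (n : nat) (T : 'M[R[i]]_n) (tau : 'M[R]_n)
    (eps : R) (T_posdef : posdef (map_mx (@complex.Im R) T)) (detT : \det T != 0)
    (tau_alt : tau^T = - tau) (eps_small : 0 < eps < 6%:R^-1) :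
  @is_dg_category R[i] (object T tau eps) (fun _ _ => form_family R n)
    (@hom_forms R n T tau eps) (@hom_diff R n T tau eps) (@hom_comp R n T tau eps).
Proof.
split.
- by move=> X Y r; exact: hom_forms0.
- by move=> X Y r c u v; exact: hom_forms_linear.
- by move=> X Y r u; exact: hom_diff_hom.
- by move=> X Y r c u v; exact: hom_diff_linear.
- by move=> X Y r u; exact: hom_diff_diff.
- by move=> X Y Z r2 r1 u v; exact: hom_comp_hom.
- move=> X Y Z r2 r1 c u u' v _ _ _; apply/funext => b; apply/funext => p.
  exact: wedge_linearl.
- move=> X Y Z r2 r1 c u v v' _ _ _; apply/funext => b; apply/funext => p.
  exact: wedge_linearr.
- by move=> X Y Z r2 r1 u v; exact: hom_leibniz.
- move=> W X Y Z r3 r2 r1 u v w _ _ _; apply/funext => b; apply/funext => p.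
  exact: wedgeA.
- move=> X; exists (@unit_form R n eps).
    by split; [exact: hom_unit_form|exact: hom_diff_unit_form].
  by split=> [Y r u|Y r u]; [exact: hom_comp_unitr|exact: hom_comp_unitl].
Qed.
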